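(* Let $T$ be a finite symmetric set of homeomorphisms of the circle $\mathbb S^1$ (if $g\in T$ then $g^{-1}\in T$), let $p$ be a probability measure on $T$ with $p(\{g\})>0$ for all $g\in T$, and let $f:T\times\mathbb S^1\to\mathbb S^1$ be the random map $f(g,x)=g(x)$. Assume that the group $G=\langle T\rangle$ possesses an exceptional minimal set $K$ (a unique invariant minimal Cantor set for the action of $G$ on $\mathbb S^1$). Let $\mu$ be the unique stationary probability measure of $f$ (which is supported in $K$), let $\eta$ be the normalized Lebesgue measure on a gap of $K$ (a connected component of $\mathbb S^1\setminus K$), and let $m=\frac12(\mu+\eta)$. Then, with respect to the reference measure $m$, $f$ satisfies conditions 1) and 2) of (FPM) and $$m(B_\omega(\mu_1)\cup\dots\cup B_\omega(\mu_r))=1\quad\text{for }\mathbb P\text{-almost every }\omega\in\Omega$$ (with $r=1$ and $\mu_1=\mu$), but $f$ does not satisfy (FPM), i.e. condition 3) does not hold.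
   Context: $\Omega=T^{\mathbb N}$, $\mathbb P=p^{\mathbb N}$, $f_t=f(t,\cdot)$, $f^0_\omega=\mathrm{id}$, $f^n_\omega=f_{\omega_n}\circ\dots\circ f_{\omega_1}$. A probability measure $\mu$ is stationary if $\mu(A)=\int\mu(f_t^{-1}A)\,dp(t)$ for all Borel $A$. It is ergodic if $\mathbb P\times\mu$ is ergodic for $F(\omega,x)=(\sigma\omega,f_{\omega_1}(x))$, with $\sigma$ the left shift. $B_\omega(\mu_i)=\{x:\frac1n\sum_{j=0}^{n-1}\delta_{f^j_\omega(x)}\to\mu_i\text{ in the weak* topology}\}$, and for bounded Borel $\psi$, $B_\omega(\mu_i,\psi)=\{x:\lim_{n\to\infty}\frac1n\sum_{j=0}^{n-1}\psi(f^j_\omega(x))=\int\psi\,d\mu_i\}$. (FPM) with respect to $m$: there exist finitely many ergodic stationary probability measures $\mu_1,\dots,\mu_r$ of $f$ such that 1) they are absolutely continuous with respect to $m$; 2) they have pairwise disjoint supports $\{d\mu_i/dm\ne0\}$ up to an $m$-null set; 3) for any bounded Borel measurable real-valued $\psi$, $m(B_\omega(\mu_1,\psi)\cup\dots\cup B_\omega(\mu_r,\psi))=1$ for $\mathbb P$-almost every $\omega$. *)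

(* Defs.v *)
From HB Require Import structures.
From mathcomp Require Import all_boot all_order all_algebra.
From mathcomp Require Import all_classical all_reals all_analysis.

Set Implicit Arguments.
Unset Strict Implicit.
Unset Printing Implicit Defensive.

Import Order.TTheory GRing.Theory Num.Theory.
Import numFieldTopology.Exports numFieldNormedType.Exports.

Local Open Scope classical_set_scope.
Local Open Scope ring_scope.

Definition circle_set (R : realType) : set (R * R) :=
  [set z | z.1 ^+ 2 + z.2 ^+ 2 = 1].

Definition circle (R : realType) : Type := set_type (@circle_set R).

HB.instance Definition _ (R : realType) :=
  PseudoMetric.copy (circle R) (set_type (@circle_set R)).

Lemma circle_expP (R : realType) (t : R) :
  (cos (2 * pi * t), sin (2 * pi * t)) \in @circle_set R.
Proof. by rewrite inE /circle_set/= cos2Dsin2. Qed.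

Definition circle_exp (R : realType) (t : R) : circle R :=
  exist _ (cos (2 * pi * t), sin (2 * pi * t)) (circle_expP t).

HB.instance Definition _ (R : realType) :=
  isPointed.Build (circle R) (circle_exp 0).

HB.instance Definition _ (R : realType) :=
  Measurable.copy (circle R) (g_sigma_algebraType (@open (circle R))).

(* Lebesgue measure of the circle, of total mass 1: the image of Lebesgue
   measure on [0, 1[ under t |-> exp (2 i pi t). *)
Definition circle_lebesgue (R : realType) (A : set (circle R)) : \bar R :=
  lebesgue_measure (`[0, 1[ `&` @circle_exp R @^-1` A).

Definition homeomorphism (X : topologicalType) (g : X -> X) : Prop :=
  continuous g /\
  exists h : X -> X, [/\ continuous h, cancel g h & cancel h g].

Definition symmetric_set (X : Type) (T : set (X -> X)) : Prop :=
  forall g, T g -> exists2 h, T h & cancel g h /\ cancel h g.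

Definition transformation_group (X : Type) (H : set (X -> X)) : Prop :=
  [/\ H idfun,
      forall g h, H g -> H h -> H (g \o h) &
      forall g, H g -> exists2 h, H h & cancel g h /\ cancel h g].

Definition generated_group (X : Type) (T : set (X -> X)) : set (X -> X) :=
  smallest (@transformation_group X) T.

Definition invariant_set (X : Type) (G : set (X -> X)) (K : set X) : Prop :=
  forall g, G g -> g @` K = K.

Definition minimal_set (X : topologicalType) (G : set (X -> X)) (K : set X) :
    Prop :=
  [/\ K !=set0, closed K, invariant_set G K &
      forall L, L !=set0 -> closed L -> invariant_set G L -> L `<=` K -> L = K].

Definition cantor_set (X : topologicalType) (K : set X) : Prop :=
  [/\ K !=set0, compact K, perfect_set K & totally_disconnected K].

Definition exceptional_minimal_set (X : topologicalType) (G : set (X -> X))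
    (K : set X) : Prop :=
  [/\ minimal_set G K, cantor_set K &
      forall L, minimal_set G L -> cantor_set L -> L = K].

Definition gap (X : topologicalType) (K I : set X) : Prop :=
  exists2 x, (~` K) x & I = connected_component (~` K) x.

Section sequences.
Context d (T : measurableType d).

Definition cylinders : set (set (nat -> T)) :=
  [set C | exists n, exists2 A : set T, measurable A &
                     C = [set w : nat -> T | A (w n)]].

(* [nat -> T] with its product sigma-algebra; the letter called omega_n for
   n >= 1 is [w n.-1]. *)
Definition Omega : measurableType cylinders.-sigma :=
  g_sigma_algebraType cylinders.

Definition shift (w : Omega) : Omega := fun n => w n.+1.

Definition product_law (R : realType) (p : probability T R)
    (P : probability Omega R) : Prop :=
  forall (n : nat) (A : nat -> set T), (forall i, measurable (A i)) ->
    P [set w : Omega | forall i, (i < n)%N -> A i (w i)] =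
    (\prod_(i < n) p (A i))%E.

End sequences.

Definition ergodic d (X : measurableType d) (R : realType)
    (Q : set X -> \bar R) (F : X -> X) : Prop :=
  [/\ measurable_fun setT F,
      forall A, measurable A -> Q (F @^-1` A) = Q A &
      forall A, measurable A -> F @^-1` A = A -> Q A = 0%E \/ Q A = 1%E].

Section random_maps.
Context d d' (T : measurableType d) (X : measurableType d') (R : realType).
Variables (f : T -> X -> X) (p : probability T R).
Variable (P : probability (Omega T) R).

Fixpoint random_orbit (w : Omega T) (x : X) (n : nat) : X :=
  if n is n'.+1 then f (w n') (random_orbit w x n') else x.

Definition stationary (mu : probability X R) : Prop :=
  forall A, measurable A -> mu A = (\int[p]_t mu (f t @^-1` A))%E.

Definition unique_stationary (mu : probability X R) : Prop :=
  stationary mu /\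
  forall nu, stationary nu -> forall A, measurable A -> nu A = mu A.

Definition skew_product (z : Omega T * X) : Omega T * X :=
  (shift z.1, f (z.1 0%N) z.2).

Definition ergodic_stationary (mu : probability X R) : Prop :=
  stationary mu /\ ergodic (P \x mu)%E skew_product.

Definition basin_fun (w : Omega T) (mu : probability X R) (psi : X -> R) :
    set X :=
  [set x | (n%:R^-1 * \sum_(0 <= j < n) psi (random_orbit w x j)) @[n --> \oo]
           --> \int[mu]_x psi x].

Section FPM.
Variable m : probability X R.

Definition FPM1 (r : nat) (mu : 'I_r -> probability X R) : Prop :=
  forall i, mu i `<< m.

Definition density_support (mu : probability X R) : set X :=
  [set x | Radon_Nikodym (charge_of_finite_measure mu) m x != 0%E].

Definition FPM2 (r : nat) (mu : 'I_r -> probability X R) : Prop :=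
  forall i j, i != j ->
    m.-negligible (density_support (mu i) `&` density_support (mu j)).

Definition FPM3 (r : nat) (mu : 'I_r -> probability X R) : Prop :=
  forall psi : X -> R, measurable_fun setT psi -> bounded_fun psi ->
    {ae P, forall w, m (\bigcup_i basin_fun w (mu i) psi) = 1%E}.

Definition FPM : Prop :=
  exists (r : nat) (mu : 'I_r -> probability X R),
    [/\ forall i, ergodic_stationary (mu i), FPM1 mu, FPM2 mu & FPM3 mu].

End FPM.
End random_maps.

Section weak_star.
Context (R : realType).

Definition weak_star_cvg (nu : nat -> {measure set (circle R) -> \bar R})
    (mu : probability (circle R) R) : Prop :=
  forall phi : circle R -> R, continuous phi ->
    \int[nu n]_x phi x @[n --> \oo] --> \int[mu]_x phi x.

Context d (T : measurableType d).
Variable f : T -> circle R -> circle R.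

Definition empirical_measure (w : Omega T) (x : circle R) (n : nat) :
    {measure set (circle R) -> \bar R} :=
  mscale (n%:R^-1)%:nng (msum (fun j => \d_(random_orbit f w x j)) n).

Definition basin (w : Omega T) (mu : probability (circle R) R) :
    set (circle R) :=
  [set x | weak_star_cvg (empirical_measure w x) mu].

End weak_star.

Section alphabet.
Context (X : choiceType) (T : set (X -> X)) (T0 : T !=set0).

(* The type of elements of [T], with the discrete sigma-algebra; measurable
   types are pointed, whence the proof [T0] that [T] is nonempty. *)
Definition alphabet (_ : T !=set0) : Type := set_type T.

HB.instance Definition _ := Choice.copy (alphabet T0) (set_type T).

HB.instance Definition _ := isPointed.Build (alphabet T0)
  (exist _ (projT1 (cid T0)) (mem_set (projT2 (cid T0)))).

HB.instance Definition _ := @isMeasurable.Build default_measure_display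
  (alphabet T0) discrete_measurable discrete_measurable0
  discrete_measurableC discrete_measurableU.

Definition alphabet_map (g : alphabet T0) : X -> X := \val g.

End alphabet.

Definition normalized_restriction d (X : measurableType d) (R : realType)
    (lam : set X -> \bar R) (I : set X) (eta : probability X R) : Prop :=
  forall A, measurable A -> eta A = (lam (A `&` I) * (fine (lam I))^-1%:E)%E.

Section half_sum.
Context d (X : measurableType d) (R : realType) (mu eta : probability X R).

Definition half_sum : set X -> \bar R :=
  mscale (2^-1)%:nng (measure_add mu eta).

HB.instance Definition _ := Measure.on half_sum.

Let half_sum_setT : half_sum setT = 1%E.
Proof.
have E : measure_add mu eta setT = 2%:E.
  by rewrite measure_addE /= (probability_setT mu) (probability_setT eta) -EFinD.
by rewrite /half_sum /mscale [X in (_ * X)%E]E -EFinM/= mulVf.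
Qed.

HB.instance Definition _ :=
  Measure_isProbability.Build _ _ _ half_sum half_sum_setT.

End half_sum.

(* Main.v *)
Require Import Defs.
From mathcomp Require Import all_boot all_order all_algebra.
From mathcomp Require Import all_classical all_reals all_analysis.
From mathcomp Require Import measurable_realfun ring lra zify.
Set Implicit Arguments.
Unset Strict Implicit.
Unset Printing Implicit Defensive.
Import Order.TTheory GRing.Theory Num.Theory.
Import numFieldTopology.Exports numFieldNormedType.Exports.
Local Open Scope classical_set_scope.
Local Open Scope ring_scope.

(** Strong law: for every point x of the circle and almost every word w, the
empirical measures of the orbit of x converge weakly to mu
([ae_basin_of_point]). This is Breiman's argument. Write Q phi (x) for the
integral of phi (g x) in the law of the letter g ([transition]). The sums of
phi (x_(j+1)) - Q phi (x_j) along the orbit are martingales with bounded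
increments; an exponential moment computed letter by letter and the
Borel-Cantelli lemma show that they are o(n), so the orbit averages of phi - Q
phi tend to 0 ([orbit_average_defect]). If the averages of some phi did not
converge to its mu-integral, then along a suitable ultrafilter the averages
would define a positive normalized functional L on bounded functions with L
(phi - Q phi) = 0 for every continuous phi and with L different from mu. By
the Riesz theorem on the circle ([riesz_representation]) this functional is a
probability measure on continuous functions; it is stationary and differs from
mu, against the uniqueness of mu ([average_cvg_of_defect]).

Almost everything in the theorem follows from this law. Fubini's theorem turns
it into m(B_w(mu)) = 1 for almost every w, for any probability m
([ae_basin_full]). Applied to one point of K, whose orbit stays in K, it shows
mu(K) = 1 ([stationary_invariant_closed]). Condition 3) fails for the
indicator function of K: a point outside K never enters K, so its averages are
0 while the integral is mu(K) = 1; hence every basin for this function lies in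
K, and m(K) = 1/2 because the gap carrying eta is disjoint from K
([not_FPM3_of_escape]). The same holds for any family of stationary measures
witnessing (FPM), since each of them equals mu.

Ergodicity ([ergodic_of_unique]) is the usual fact that a unique stationary
measure is extremal. For an invariant set A, the function h(x) = P(A_x) is
harmonic, hence invariant almost everywhere ([harmonic_ae_invariant]), so h mu
is a multiple of a stationary measure and h is almost everywhere a constant c;
reading letters one at a time then shows that A is independent of all
rectangles, hence of itself ([invariant_set_full]). *)

(** * The circle as a compact Borel space *)

Lemma compact_unif_continuous (R : realType) (X Y : pseudoMetricType R)
    (A : set X) (f : X -> Y) : compact A -> continuous f ->
  forall e, 0 < e ->
  exists2 d, 0 < d & forall x y, A x -> ball x d y -> ball (f x) e (f y).
Proof.
move=> /compact_near_coveringP Acov fcont e e0.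
pose Q (d : R) (x : X) := forall y, ball x d y -> ball (f x) e (f y).
have : \forall d \near (0 : R)^'+, A `<=` Q d.
  apply: Acov => x Ax.
  have e20 : 0 < e / 2 by rewrite divr_gt0.
  have /nbhs_ballP[r /= r0 rf] : nbhs x (f @^-1` ball (f x) (e / 2)).
    by apply: fcont; exact: nbhsx_ballx.
  have r20 : 0 < r / 2 by rewrite divr_gt0.
  exists (ball x (r / 2), [set d : R | d < r / 2]) => /=.
    by split; [exact: nbhsx_ballx|exact: nbhs_right_lt].
  move=> [x' d] /= [xx' dr] y xy.
  apply: (@ball_splitr _ _ (f x)).
    by apply: rf; apply: le_ball xx'; rewrite ler_pdivrMr// ler_peMr ?ler1n ?ltW.
  apply: rf; apply: (ball_split xx'); exact: le_ball (ltW dr) _ xy.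
move=> H.
have [d /= [d0 dA]] : exists d : R, 0 < d /\ A `<=` Q d.
  near (0:R)^'+ => d; exists d; split; first by near: d; exact: nbhs_right_gt.
  by near: d.
by exists d => // x y Ax; exact: dA.
Unshelve. all: by end_near. Qed.

Section circle_geometry.
Context (R : realType).
Implicit Types (z w : circle R).

Lemma circle_exp_continuous : continuous (@circle_exp R).
Proof.
move=> t; apply/cvg_ballP => e e0.
have c1 : cos (2 * pi * u) @[u --> t] --> cos (2 * pi * t).
  by apply: (continuous_comp (f := fun t : R => 2 * pi * t));
    [exact: mulrl_continuous|exact: continuous_cos].
have c2 : sin (2 * pi * u) @[u --> t] --> sin (2 * pi * t).
  by apply: (continuous_comp (f := fun t : R => 2 * pi * t));
    [exact: mulrl_continuous|exact: continuous_sin].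
have /cvg_ballP b1 := c1.
have /cvg_ballP b2 := c2.
near=> u; split => /=; near: u; [exact: b1|exact: b2].
Unshelve. all: by end_near. Qed.

Lemma circle_exp_surj z : exists t : R, 0 <= t < 1 /\ circle_exp t = z.
Proof.
case: z => -[x y] Pz; have /set_mem/= := Pz; rewrite /circle_set/= => xy1.
have x21 : x ^+ 2 <= 1 by rewrite -xy1 lerDl sqr_ge0.
have xB : -1 <= x <= 1 by rewrite -ler_norml -(@expr_le1 _ 2)// real_normK ?num_real.
have pi20 : 0 < 2 * pi :> R by rewrite mulr_gt0 ?pi_gt0.
have sinE : sin (acos x) = `|y|.
  by rewrite sin_acos// -xy1 addrAC subrr add0r sqrtr_sqr.
have e u (t : R) : u = (x, y) -> (cos (2 * pi * t), sin (2 * pi * t)) = u ->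
    circle_exp t = exist _ (x, y) Pz.
  by move=> -> tE; apply/val_inj.
have [y0|y0] := leP 0 y.
  exists (acos x / (2 * pi)); split.
    rewrite divr_ge0 ?acos_ge0 ?(ltW pi20)//= ltr_pdivrMr// mul1r.
    by rewrite (le_lt_trans (acos_lepi xB))// ltr_pMl ?pi_gt0// ltr1n.
  apply: (e _ _ erefl); rewrite mulrCA divff ?gt_eqF// mulr1.
  by rewrite acosK// sinE ger0_norm.
exists (1 - acos x / (2 * pi)); split.
  rewrite subr_ge0 ler_pdivrMr// mul1r (le_trans (acos_lepi xB))/=; last first.
    by rewrite ler_peMl ?pi_ge0// ler1n.
  rewrite ltrBlDr ltrDl divr_gt0// acos_gt0//.
  have /andP[-> x1] := xB; rewrite lt_neqAle x1 andbT/=.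
  apply/negP => /eqP x1E; move: xy1; rewrite x1E expr1n => /eqP.
  by rewrite -subr_eq0 addrAC subrr add0r expf_eq0/= (lt_eqF y0).
apply: (e _ _ erefl).
rewrite mulrBr mulr1 mulrCA divff ?gt_eqF// mulr1.
have -> : 2 * pi - acos x = - acos x + pi *+ 2 by rewrite mulr_natl addrC.
by rewrite cosD2pi sinD2pi cosN sinN acosK// sinE ltr0_norm// opprK.
Qed.

Definition circle_arg z : R := projT1 (cid (circle_exp_surj z)).

Lemma circle_arg_itv z : 0 <= circle_arg z < 1.
Proof. by rewrite /circle_arg; case: cid => t []. Qed.

Lemma circle_argK : cancel circle_arg (@circle_exp R).
Proof. by move=> z; rewrite /circle_arg; case: cid => t []. Qed.

Lemma circle_compact : compact [set: circle R].
Proof.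
have -> : [set: circle R] = @circle_exp R @` `[0, 1].
  apply/seteqP; split => // z _; exists (circle_arg z); last exact: circle_argK.
  by have /andP[a0 a1] := circle_arg_itv z; rewrite /= in_itv/= a0 ltW.
apply: continuous_compact; last exact: segment_compact.
by apply: continuous_subspaceT; exact: circle_exp_continuous.
Qed.

Lemma circle_continuous_bounded (phi : circle R -> R) : continuous phi ->
  exists2 M, 0 < M & forall z, `|phi z| <= M.
Proof.
move=> phic; have : compact (phi @` [set: circle R]).
  apply: continuous_compact; last exact: circle_compact.
  exact: continuous_subspaceT.
move=> /compact_bounded[M [_ H]].
exists (Num.max 1 (M + 1)); first by rewrite lt_max ltr01.
move=> z; apply: (H (Num.max 1 (M + 1))); last by exists z.
by rewrite lt_max ltrDl ltr01 orbT.
Qed.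

Lemma circle_continuous_measurable (phi : circle R -> R) :
  continuous phi -> measurable_fun setT phi.
Proof.
move=> phic; apply: (measurability (@RGenOpens.G R)).
  exact: RGenOpens.measurableE.
move=> _ [_ [a [b ->]] <-]; rewrite setTI; apply: sub_sigma_algebra => /=.
by apply: open_comp => [? _|]; [exact: phic|exact: interval_open].
Qed.

Lemma circle_open_measurable (U : set (circle R)) : open U -> measurable U.
Proof. exact: sub_sigma_algebra. Qed.

Lemma circle_closed_measurable (U : set (circle R)) : closed U -> measurable U.
Proof.
move=> Uc; rewrite -(setCK U); apply: measurableC.
by apply: circle_open_measurable; exact: closed_openC.
Qed.

Lemma circle_map_measurable (g : circle R -> circle R) :
  continuous g -> measurable_fun setT g.
Proof.
move=> gc; apply: (measurability (@open (circle R))) => //.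
move=> _ [U Uo <-]; rewrite setTI; apply: circle_open_measurable.
by apply: open_comp => // ? _; exact: gc.
Qed.

Lemma circle_exp_measurable : measurable_fun setT (@circle_exp R).
Proof.
apply: (measurability (@open (circle R))) => //.
move=> _ [U Uo <-]; rewrite setTI; apply: open_measurable.
by apply: open_comp => // ? _; exact: circle_exp_continuous.
Qed.

End circle_geometry.

(** * A countable partition of unity on the circle *)

Section continuous_expressions.
Context (R : realType) (X : topologicalType).

Lemma continuous_max0B (h : X -> R) (a : R) :
  continuous h -> continuous (fun x => Num.max 0 (a - h x)).
Proof.
move=> hc x; apply: (@continuous_max R X (fun=> 0) (fun x => a - h x)).
  exact: cst_continuous.
by apply: cvgB; [exact: cvg_cst|exact: hc].
Qed.

Lemma continuous_ratio_sum (f : nat -> X -> R) (m i : nat) :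
  (forall j, continuous (f j)) -> (forall x, \sum_(j < m) f j x != 0) ->
  continuous (fun x => f i x / \sum_(j < m) f j x).
Proof.
move=> fc f0 x; apply: cvgM; first exact: fc.
apply: cvgV; first exact: f0.
by apply: cvg_big => [|j _]; [exact: add_continuous|exact: fc].
Qed.

End continuous_expressions.

Section partition_of_unity.
Context (R : realType).
Implicit Types (z w : circle R).

Lemma unit_itv_step (t : R) (n : nat) : 0 <= t < 1 ->
  exists2 i, (i <= n)%N & i%:R / n.+1%:R <= t < i.+1%:R / n.+1%:R.
Proof.
move=> /andP[t0 t1]; have n0 : 0 < n.+1%:R :> R by rewrite ltr0n.
have tn0 : 0 <= t * n.+1%:R by rewrite mulr_ge0// ltW.
have /andP[lo hi] := truncn_itv tn0.
exists (Num.truncn (t * n.+1%:R)).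
  rewrite -ltnS -(ltr_nat R) (le_lt_trans lo)//.
  by rewrite -[ltRHS]mul1r ltr_pM2r.
by rewrite ler_pdivrMr// lo ltr_pdivlMr.
Qed.

(** Regular subdivisions of [0, 1] give step approximations of functions on
   the circle, uniformly; the net below and the Riemann sums of the Riesz
   theorem are built on them. *)
Lemma circle_exp_unif_continuous (Y : pseudoMetricType R) (f : circle R -> Y) :
  continuous f -> forall e, 0 < e -> exists n : nat, forall (i : nat) (t : R),
  (i <= n)%N -> i%:R / n.+1%:R <= t <= i.+1%:R / n.+1%:R ->
  ball (f (circle_exp (i%:R / n.+1%:R))) e (f (circle_exp t)).
Proof.
move=> fc e e0.
have fec : continuous (f \o @circle_exp R).
  by move=> t; apply: continuous_comp; [exact: circle_exp_continuous|exact: fc].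
have [d d0 H] := compact_unif_continuous (@segment_compact _ 0 1) fec e0.
exists (Num.truncn d^-1) => i t; set n := Num.truncn _ => lin /andP[it ti].
have n0 : 0 < n.+1%:R :> R by rewrite ltr0n.
apply: H => /=.
  by rewrite in_itv/= divr_ge0//= ler_pdivrMr// mul1r ler_nat ltnW.
have nd : n.+1%:R^-1 < d.
  by rewrite -[ltRHS]invrK ltf_pV2 ?posrE ?invr_gt0// truncnS_gt.
rewrite /ball/= ler0_norm ?subr_le0// opprB (le_lt_trans _ nd)//.
by rewrite lerBlDr -[X in X + _]mul1r -mulrDl nat1r.
Qed.

Lemma circle_net (e : R) : 0 < e ->
  exists s : seq (circle R), forall z, exists2 c, c \in s & ball c e z.
Proof.
move=> e0.
have [n H] := @circle_exp_unif_continuous _ idfun (fun _ => cvg_id) e e0.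
exists [seq circle_exp (i%:R / n.+1%:R) | i <- iota 0 n.+1] => z.
have [i lin /andP[it ti]] := unit_itv_step n (circle_arg_itv z).
exists (circle_exp (i%:R / n.+1%:R)).
  by apply/mapP; exists i => //; rewrite mem_iota.
by rewrite -[z]circle_argK; apply: H => //; rewrite it ltW.
Qed.

(** One net per scale 1 / (n + 1), so that the functions [partition_unity n i]
   form a countable family. *)
Definition net n : seq (circle R) :=
  projT1 (cid (@circle_net n.+1%:R^-1 ltac:(by rewrite invr_gt0))).

Definition bump n (i : nat) z : R :=
  if (i < size (net n))%N then
    Num.max 0 (n.+1%:R^-1 - `|\val (nth point (net n) i) - \val z|)
  else 0.

Definition partition_unity n i z : R :=
  bump n i z / \sum_(j < size (net n)) bump n j z.

Lemma bump_ge0 n i z : 0 <= bump n i z.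
Proof. by rewrite /bump; case: ifP => // _; rewrite le_max lexx. Qed.

Lemma circle_ballE z e w : ball z e w <-> `|\val z - \val w| < e.
Proof.
rewrite -[ball z e w]/(@ball R (R * R)%type (\val z) e (\val w)).
by rewrite -[X in X _ _ _ <-> _]ball_normE.
Qed.

Lemma net_cover n z : exists2 c, c \in net n & ball c n.+1%:R^-1 z.
Proof. by rewrite /net; case: cid => s /=; exact. Qed.

Lemma bump_sum_gt0 n z : 0 < \sum_(j < size (net n)) bump n j z.
Proof.
have [c cs /circle_ballE cz] := net_cover n z.
have ic : (index c (net n) < size (net n))%N by rewrite index_mem.
rewrite (bigD1 (Ordinal ic))//= ltr_pwDl//; last first.
  by apply: sumr_ge0 => *; exact: bump_ge0.
by rewrite /bump ic nth_index// lt_max subr_gt0 cz orbT.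
Qed.

Lemma bump_continuous n i : continuous (bump n i).
Proof.
rewrite /bump; set c := nth point (net n) i.
case: (i < _)%N; last exact: cst_continuous.
apply: (@continuous_max0B R (circle R) (fun w => `|\val c - \val w|)) => z.
have cz : `|\val c - \val w| @[w --> z] --> `|\val c - \val z|.
  apply/(@cvgrPdist_lt _ _ _ (nbhs z) _
    (fun w : circle R => `|\val c - \val w|)) => e e0; near=> w.
  rewrite (le_lt_trans (ler_dist_dist _ _))//.
  rewrite opprB addrC subrKA distrC.
  by apply/circle_ballE; near: w; exact: nbhsx_ballx.
exact: cz.
Unshelve. all: by end_near. Qed.

Lemma partition_unity_continuous n i : continuous (partition_unity n i).
Proof.
apply: (@continuous_ratio_sum R (circle R) (bump n) (size (net n)) i) => [j|z].
  exact: bump_continuous.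
by rewrite gt_eqF// bump_sum_gt0.
Qed.

Lemma partition_unity_sum n z :
  \sum_(i < size (net n)) partition_unity n i z = 1.
Proof. by rewrite -mulr_suml divff// gt_eqF// bump_sum_gt0. Qed.

Lemma partition_unity_ge0 n i z : 0 <= partition_unity n i z.
Proof. by rewrite divr_ge0 ?bump_ge0 ?(ltW (bump_sum_gt0 _ _)). Qed.

Lemma partition_unity_norm_le1 n (i : nat) z : `|partition_unity n i z| <= 1.
Proof.
rewrite ger0_norm ?partition_unity_ge0//.
have [isz|isz] := boolP (i < size (net n))%N; last first.
  by rewrite /partition_unity /bump (negbTE isz) mul0r.
rewrite -(partition_unity_sum n z) (bigD1 (Ordinal isz))//= lerDl.
by apply: sumr_ge0 => j _; exact: partition_unity_ge0.
Qed.

Lemma partition_unity_support n i z : partition_unity n i z != 0 ->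
  ball (nth point (net n) i) n.+1%:R^-1 z.
Proof.
move=> p0; have : bump n i z != 0.
  by apply: contra p0 => /eqP b0; rewrite /partition_unity b0 mul0r.
have : 0 <= bump n i z := bump_ge0 _ _ _.
rewrite le_eqVlt eq_sym => /orP[->//|+ _].
rewrite /bump; case: ifP => _; last by rewrite ltxx.
rewrite lt_max ltxx/= subr_gt0 => h.
exact/circle_ballE.
Qed.

(** A term of the sum at z has its center within 1 / (n + 1) of z, where phi
   is close to phi z by uniform continuity. Thus convergence of averages,
   which is asked for every continuous function, can be tested on countably
   many of them. *)
Lemma partition_unity_approx (phi : circle R -> R) : continuous phi ->
  forall e, 0 < e -> exists n, forall z,
  `|phi z - \sum_(i < size (net n)) phi (nth point (net n) i) *
              partition_unity n i z| <= e.
Proof.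
move=> phic e e0.
have [d d0 H] := compact_unif_continuous (@circle_compact R) phic e0.
exists (Num.truncn d^-1) => z; set n := Num.truncn _.
have nd : n.+1%:R^-1 < d.
  by rewrite -[ltRHS]invrK ltf_pV2 ?posrE ?invr_gt0// truncnS_gt.
rewrite -[phi z]mulr1 -{1}(partition_unity_sum n z) mulr_sumr -sumrB.
rewrite (le_trans (ler_norm_sum _ _ _))//.
rewrite -[leRHS]mulr1 -(partition_unity_sum n z) mulr_sumr ler_sum// => i _.
rewrite -mulrBl normrM [`|partition_unity n i z|]ger0_norm ?partition_unity_ge0//.
have [->|p0] := eqVneq (partition_unity n i z) 0; first by rewrite !mulr0.
rewrite ler_wpM2r ?partition_unity_ge0//.
suff : ball (nth point (net n) i) d z.
  by move=> /(H _ _ I); rewrite distrC /ball/= => /ltW.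
exact: le_ball (ltW nd) _ (partition_unity_support p0).
Qed.

End partition_of_unity.

(** * Measures on the space of infinite words *)

Section images_of_measures.
Context d d' (X : measurableType d) (Y : measurableType d') (R : realType).
Variables (f : X -> Y) (mf : measurable_fun setT f).

Definition image_measure (m : {measure set X -> \bar R}) :
  {measure set Y -> \bar R}.
Proof. by unshelve refine (pushforward m f : {measure set Y -> \bar R}). Defined.

Definition image_probability (P : probability X R) : probability Y R :=
  distribution P (mfun_Sub (mem_set mf)).

End images_of_measures.

Section sequence_space.
Context d (T : measurableType d) (R : realType).
Implicit Types (w : Omega T) (A : nat -> set T).

Definition box n A : set (Omega T) :=
  [set w | forall i, (i < n)%N -> A i (w i)].

Lemma measurable_letter n : measurable_fun setT (fun w : Omega T => w n).
Proof.
move=> _ A mA; rewrite setTI; apply: sub_sigma_algebra.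
by exists n; exists A.
Qed.

Lemma boxE n A : box n A = \bigcap_(i < n) ((fun w : Omega T => w i) @^-1` A i).
Proof. by []. Qed.

Lemma measurable_box n A : (forall i, measurable (A i)) -> measurable (box n A).
Proof.
move=> mA; rewrite boxE; apply: bigcap_measurableType => i _.
by rewrite -[X in measurable X]setTI; exact: measurable_letter.
Qed.

(** Boxes, unlike the one-coordinate cylinders that define the sigma-algebra,
   are stable under intersection. *)
Lemma Omega_measure_unique (m1 m2 : {measure set (Omega T) -> \bar R}) :
  (m1 setT < +oo)%E ->
  (forall n A, (forall i, measurable (A i)) -> m1 (box n A) = m2 (box n A)) ->
  forall E, measurable E -> m1 E = m2 E.
Proof.
move=> m1oo m12.
pose G := [set C | exists n A, (forall i, measurable (A i)) /\ C = box n A].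
have box0 : [set: Omega T] = box 0 (fun=> setT) by apply/seteqP.
apply: (measure_unique G (fun=> setT)) => //.
- apply/seteqP; split => C.
    apply: smallest_sub; first exact: smallest_sigma_algebra.
    move=> _ [n [A mA ->]]; apply: sub_sigma_algebra.
    exists n.+1, (fun i => if i == n then A else setT); split.
      by move=> i; case: ifP.
    apply/seteqP; split => w /=.
      by move=> Aw i _; case: eqP => // ->.
    by move=> /(_ n (ltnSn n)); rewrite eqxx.
  apply: smallest_sub; first exact: sigma_algebra_measurable.
  by move=> _ [n [A [mA ->]]]; exact: measurable_box.
- move=> _ _ [n [A [mA ->]]] [k [B [mB ->]]].
  exists (maxn n k), (fun i => (if (i < n)%N then A i else setT) `&`
                         (if (i < k)%N then B i else setT)); split.
    by move=> i; apply: measurableI; case: ifP.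
  apply/seteqP; split => w /=.
    by move=> [Aw Bw] i _; split; case: ifPn => // ?; [exact: Aw|exact: Bw].
  move=> ABw; split => i ik.
    by have := ABw i; rewrite leq_max ik => /(_ isT)[].
  by have := ABw i; rewrite leq_max ik orbT => /(_ isT)[].
- by move=> i; exists 0%N, (fun=> setT).
- by apply/seteqP; split => // x _; exists 0%N.
- by move=> _ [n [A [mA ->]]]; exact: m12.
Qed.

Definition prepend (z : T * Omega T) : Omega T :=
  fun n => if n is k.+1 then z.2 k else z.1.

Lemma measurable_prepend : measurable_fun setT prepend.
Proof.
apply: (@measurability _ _ _ (Omega T) _ _ (@cylinders _ T)) => //.
move=> _ [_ [[|n] [A mA ->]] <-].
  have -> : [set: T * Omega T] `&` prepend @^-1` [set w | A (w 0%N)] =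
    setT `&` fst @^-1` A by [].
  exact: measurable_fst.
have -> : [set: T * Omega T] `&` prepend @^-1` [set w | A (w n.+1)] =
    setT `&` ((fun w : Omega T => w n) \o snd) @^-1` A by [].
apply: (measurableT_comp (measurable_letter n) measurable_snd) => //.
Qed.

Lemma measurable_shift : measurable_fun setT (@Defs.shift _ T).
Proof.
apply: (@measurability _ _ _ (Omega T) _ _ (@cylinders _ T)) => //.
move=> _ [_ [n [A mA ->]] <-].
have -> : [set: Omega T] `&` @Defs.shift _ T @^-1` [set w | A (w n)] =
    setT `&` (fun w : Omega T => w n.+1) @^-1` A by [].
exact: measurable_letter.
Qed.

Variables (p : probability T R) (P : probability (Omega T) R).
Hypothesis Pprod : product_law p P.

(** The Markov property at time 1: a random word is an independent first
   letter followed by a random word. All later computations over words are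
   inductions that split off this letter. *)
Lemma prepend_law E : measurable E -> P E = (p \x P)%E (prepend @^-1` E).
Proof.
move=> mE.
have mprep := measurable_prepend.
pose m2 := image_measure mprep (p \x P)%E.
suff : P E = m2 E by [].
move: E mE; apply: Omega_measure_unique => [|n A mA].
  exact: (le_lt_trans (probability_le1 P measurableT) (ltry 1)).
transitivity (\prod_(i < n) p (A i))%E; first exact: Pprod.
rewrite (_ : m2 _ = (p \x P)%E (prepend @^-1` box n A))//.
case: n => [|n].
  rewrite big_ord0 (_ : prepend @^-1` _ = setT); last by apply/seteqP; split.
  exact/esym/(probability_setT (p \x P)%E).
rewrite (_ : prepend @^-1` _ = A 0%N `*` box n (fun i => A i.+1)).
  rewrite product_measure1E//; last exact: measurable_box.
  by rewrite big_ord_recl; congr (_ * _)%E; apply/esym/Pprod.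
apply/seteqP; split => -[t w] /=.
  move=> H; split; first exact: (H 0%N).
  by move=> i ilt; exact: (H i.+1).
by move=> [A0 H] [|i] ilt //; exact: H.
Qed.

Lemma ge0_integral_prepend (g : Omega T -> \bar R) :
  measurable_fun setT g -> (forall w, 0 <= g w)%E ->
  (\int[P]_w g w = \int[p]_t \int[P]_w g (prepend (t, w)))%E.
Proof.
move=> mg g0.
have mprep := measurable_prepend.
pose m2 := image_measure mprep (p \x P)%E.
rewrite (eq_measure_integral m2); last by move=> A mA _; exact: prepend_law.
rewrite /m2 /image_measure/=.
rewrite ge0_integral_pushforward// preimage_setT fubini_tonelli1//=.
exact: measurableT_comp.
Qed.

End sequence_space.

(** * A strong law of large numbers along random orbits *)

(** From exp (- y) >= 1 - y, because (1 + y + 2 y^2) (1 - y) = 1 + y^2 (1 - 2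
   y) >= 1 in this range. *)
Lemma expR_le_quadratic (R : realType) (y : R) : `|y| <= 2^-1 ->
  expR y <= 1 + y + 2 * y ^+ 2.
Proof.
rewrite ler_norml => /andP[y1 y2].
have h : 0 < 1 - y by rewrite subr_gt0 (le_lt_trans y2)// invf_lt1 ?ltr1n.
have e : 1 - y <= expR (- y) := expR_ge1Dx (- y).
have : expR y * (1 - y) <= 1.
  by rewrite (le_trans (ler_wpM2l (expR_ge0 y) e))// -expRD subrr expR0.
rewrite -ler_pdivlMr// => /le_trans; apply.
rewrite div1r -[leLHS]mul1r ler_pdivrMr//.
have -> : (1 + y + 2 * y ^+ 2) * (1 - y) = 1 + y ^+ 2 * (1 - 2 * y).
  by rewrite expr2; ring.
rewrite lerDl mulr_ge0 ?sqr_ge0// subr_ge0.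
by rewrite -ler_pdivlMl// mulr1.
Qed.

Lemma geometric_nneseries_lty (R : realType) (r : R) : 0 <= r < 1 ->
  (\sum_(n <oo) (r ^+ n)%:E < +oo)%E.
Proof.
move=> /andP[r0 r1]; apply: (@le_lt_trans _ _ (1 - r)^-1%:E); last exact: ltry.
apply: lime_le; first by apply: is_cvg_nneseries => n _ _; rewrite lee_fin exprn_ge0.
apply: nearW => n; rewrite sumEFin lee_fin.
have := geometric_seriesE 1 (negbT (lt_eqF r1)).
move=> /(congr1 (fun u => u n)); rewrite /series/= => e.
under eq_bigr do rewrite -[_ ^+ _]mul1r.
rewrite e mul1r -[leRHS]mul1r ler_pM2r ?invr_gt0 ?subr_gt0//.
by rewrite lerBlDr lerDl exprn_ge0.
Qed.

(** The Borel-Cantelli lemma for events of geometrically decreasing measure.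
   *)
Lemma ae_eventually d (X : measurableType d) (R : realType)
    (mu : {measure set X -> \bar R}) (E : nat -> set X) (r : R) :
  (forall n, measurable (E n)) -> 0 <= r < 1 ->
  (forall n, mu (E n) <= (r ^+ n)%:E)%E ->
  {ae mu, forall x, \forall n \near \oo, ~ E n x}.
Proof.
move=> mE r01 Er; exists (lim_sup_set E); split.
- apply: bigcapT_measurable => n; exact: bigcup_measurable.
- apply: lim_sup_set_cvg0 => //.
  apply: le_lt_trans (geometric_nneseries_lty r01).
  by apply: lee_nneseries => n _ //.
- move=> x /= H n _; apply: contrapT => /= NE.
  apply: H; exists n => //= k /= nk Ek.
  by apply: NE; exists k.
Qed.

Section bounded_functions.
Context d (X : measurableType d) (R : realType) (mu : probability X R).

(** The normalization of a probability, stated for its coercion to measures,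
   which is the form that integrals of constants produce. *)
Lemma measure_probT : (mu : {measure set X -> \bar R}) setT = 1%E.
Proof. exact: probability_setT. Qed.

Lemma bounded_integrable (h : X -> R) (M : R) : measurable_fun setT h ->
  (forall x, `|h x| <= M) -> mu.-integrable setT (EFin \o h).
Proof.
move=> mh hM; apply: measurable_bounded_integrable => //.
  exact: (le_lt_trans (probability_le1 mu measurableT) (ltry 1)).
exists M; split; first exact: num_real.
by move=> y My t _ /=; rewrite (le_trans (hM _))// ltW.
Qed.

Lemma Rintegral_prob_cst (c : R) : \int[mu]_x c = c.
Proof. by rewrite Rintegral_cst// measure_probT mulr1. Qed.

Lemma Rintegral_bounded (h : X -> R) (M : R) : measurable_fun setT h ->
  (forall x, `|h x| <= M) -> `|\int[mu]_x h x| <= M.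
Proof.
move=> mh hM; have ih := bounded_integrable mh hM.
rewrite (le_trans (le_normr_Rintegral measurableT ih))//.
rewrite -[leRHS]Rintegral_prob_cst; apply: le_Rintegral => //.
  apply: (@bounded_integrable _ M); first exact: measurableT_comp.
  by move=> x; rewrite normr_id.
by apply: (@bounded_integrable _ `|M|).
Qed.

Lemma EFin_Rintegral (h : X -> R) : mu.-integrable setT (EFin \o h) ->
  (\int[mu]_x (h x)%:E = (\int[mu]_x h x)%R%:E)%E.
Proof. by move=> ih; rewrite /Rintegral fineK//; exact: integrable_fin_num. Qed.

End bounded_functions.

Section orbits.
Context d d' (T : measurableType d) (X : measurableType d') (R : realType).
Variables (f : T -> X -> X) (p : probability T R) (P : probability (Omega T) R).
Hypothesis mf : measurable_fun setT (fun z : T * X => f z.1 z.2).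
Hypothesis Pprod : product_law p P.

Lemma random_orbit_prepend t w x n :
  random_orbit f (prepend (t, w)) x n.+1 = random_orbit f w (f t x) n.
Proof. by elim: n => //= n ->. Qed.

Lemma measurable_random_orbit n :
  measurable_fun setT (fun z : Omega T * X => random_orbit f z.1 z.2 n).
Proof.
elim: n => [|n ih] /=; first exact: measurable_snd.
have h : measurable_fun setT
    (fun z : Omega T * X => (z.1 n, random_orbit f z.1 z.2 n)).
  apply/measurable_fun_pair => //.
  exact: (measurableT_comp (measurable_letter n) measurable_fst).
exact: (measurableT_comp mf h).
Qed.

Lemma measurable_random_orbit_letters n x :
  measurable_fun setT (fun w : Omega T => random_orbit f w x n).
Proof. exact: (measurable_fun_pair1 x (measurable_random_orbit n)). Qed.

Section martingale.
Variables (phi psi : X -> R) (M : R).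
Hypotheses (mphi : measurable_fun setT phi) (mpsi : measurable_fun setT psi).
Hypotheses (M0 : 0 < M) (phiM : forall x, `|phi x| <= M).
Hypothesis psiE : forall x, \int[p]_t phi (f t x) = psi x.

(** The martingale part of the sum of phi along the orbit: each value of phi
   is compensated by its conditional expectation given the previous position.
   *)
Definition compensated_sum n w x : R :=
  \sum_(j < n) (phi (random_orbit f w x j.+1) - psi (random_orbit f w x j)).

Lemma compensated_sum_prepend n t w x :
  compensated_sum n.+1 (prepend (t, w)) x =
  (phi (f t x) - psi x) + compensated_sum n w (f t x).
Proof.
rewrite /compensated_sum big_ord_recl; congr (_ + _).
by apply: eq_bigr => i _; rewrite !random_orbit_prepend.
Qed.

Lemma measurable_compensated_sum n x :
  measurable_fun setT (compensated_sum n ^~ x).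
Proof.
apply: measurable_sum => i; apply: measurable_funB.
  by apply: measurableT_comp => //; exact: measurable_random_orbit_letters.
by apply: measurableT_comp => //; exact: measurable_random_orbit_letters.
Qed.

Let mphif x : measurable_fun setT (fun t => phi (f t x)).
Proof. by apply: measurableT_comp => //; exact: measurable_fun_pair1 mf. Qed.

Let psiM x : `|psi x| <= M.
Proof. by rewrite -psiE; exact: Rintegral_bounded. Qed.

(** The linear term of the quadratic bound of exp vanishes because the
   increment phi (f t x) - psi x has mean 0; the increment is at most 2 M in
   absolute value. *)
Let step_moment (l : R) x : `|l| * (2 * M) <= 2^-1 ->
  (\int[p]_t (expR (l * (phi (f t x) - psi x)))%:E <=
   (expR (8 * M ^+ 2 * l ^+ 2))%:E)%E.
Proof.
move=> lM; set c := 8 * M ^+ 2 * l ^+ 2.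
pose g t := (1 + c - l * psi x) + l * phi (f t x).
have ig1 : p.-integrable setT (EFin \o (fun=> 1 + c - l * psi x)).
  exact: (@bounded_integrable _ _ _ _ _ `|1 + c - l * psi x|).
have iphi : p.-integrable setT (EFin \o (fun t => phi (f t x))).
  exact: bounded_integrable (mphif x) _.
have ig2 : p.-integrable setT (EFin \o (fun t => l * phi (f t x))).
  apply: (@bounded_integrable _ _ _ _ _ (`|l| * M)).
    by apply: measurable_funM => //; exact: mphif.
  by move=> t; rewrite normrM ler_wpM2l.
have DM t : `|phi (f t x) - psi x| <= 2 * M.
  rewrite (le_trans (ler_normB _ _))// mulr_natl mulr2n lerD//.
apply: (@le_trans _ _ (\int[p]_t (g t)%:E)%E).
  apply: ge0_le_integral => //.
  - apply/measurable_EFinP; apply: measurableT_comp => //.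
    by apply: measurable_funM => //; apply: measurable_funB => //; exact: mphif.
  - apply/measurable_EFinP; apply: measurable_funD => //.
    by apply: measurable_funM => //; exact: mphif.
  - move=> t _; rewrite lee_fin (le_trans (expR_le_quadratic _))//.
      by rewrite normrM (le_trans _ lM)// ler_wpM2l.
    rewrite /g; suff : 2 * (l * (phi (f t x) - psi x)) ^+ 2 <= c by lra.
    rewrite exprMn /c.
    have : (phi (f t x) - psi x) ^+ 2 <= (2 * M) ^+ 2.
      by rewrite -real_normK ?num_real// lerXn2r ?nnegrE ?mulr_ge0// ltW.
    move=> /(ler_wpM2l (sqr_ge0 l)); rewrite exprMn; lra.
rewrite EFin_Rintegral; last first.
  rewrite (_ : EFin \o g = (EFin \o (fun=> (1 + c - l * psi x)%R)) \+
    (EFin \o (fun t => (l * phi (f t x))%R)))%E//.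
  exact: integrableD.
rewrite lee_fin /g RintegralD// Rintegral_prob_cst RintegralZl// psiE subrK.
exact: expR_ge1Dx.
Qed.

(** By induction on n for all starting points at once: the first letter
   contributes the factor of [step_moment], and the rest is a shorter sum
   started at f t x. *)
Lemma compensated_sum_moment (l : R) n x : `|l| * (2 * M) <= 2^-1 ->
  (\int[P]_w (expR (l * compensated_sum n w x))%:E <=
   (expR (8 * M ^+ 2 * l ^+ 2 * n%:R))%:E)%E.
Proof.
move=> lM; set c := 8 * M ^+ 2 * l ^+ 2.
elim: n x => [|n ih] x.
  under eq_integral do rewrite /compensated_sum big_ord0 mulr0 expR0.
  by rewrite mulr0 expR0 integral_cst// measure_probT mule1.
rewrite (ge0_integral_prepend Pprod); last 2 first.
  apply/measurable_EFinP; apply: measurableT_comp => //.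
  by apply: measurable_funM => //; exact: measurable_compensated_sum.
  by move=> w; rewrite lee_fin expR_ge0.
have mstep : measurable_fun setT
    (fun t => (expR (l * (phi (f t x) - psi x)))%:E).
  apply/measurable_EFinP; apply: measurableT_comp => //.
  by apply: measurable_funM => //; apply: measurable_funB => //; exact: mphif.
apply: (@le_trans _ _ (\int[p]_t ((expR (l * (phi (f t x) - psi x)))%:E *
    (expR (c * n%:R))%:E))%E).
  apply: ge0_le_integral => //.
  - by move=> t _; apply: integral_ge0 => w _; rewrite lee_fin expR_ge0.
  - pose G z := (expR (l * compensated_sum n.+1 (@prepend _ T z) x))%:E.
    apply: (@measurable_fun_fubini_tonelli_F _ _ _ _ _ P G) => //.
      apply/measurable_EFinP; apply: measurableT_comp => //.
      apply: measurable_funM => //.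
      exact: measurableT_comp (measurable_compensated_sum n.+1 x)
        (@measurable_prepend _ T).
    by move=> z; rewrite lee_fin expR_ge0.
  - exact: emeasurable_funM.
  - move=> t _; under eq_integral => w _ do
      rewrite compensated_sum_prepend mulrDr expRD EFinM.
    rewrite ge0_integralZl//=.
    + by rewrite lee_wpmul2l// ?lee_fin ?expR_ge0.
    + apply/measurable_EFinP; apply: measurableT_comp => //.
      by apply: measurable_funM => //; exact: measurable_compensated_sum.
rewrite ge0_integralZr//.
rewrite -natr1 mulrDr mulr1 expRD muleC EFinM lee_wpmul2l ?lee_fin ?expR_ge0//.
exact: step_moment.
Qed.

(** Chernoff's bound: Markov's inequality for exp (l S_n), with l small enough
   that 8 M^2 l^2 <= l e / 2. *)
Lemma compensated_sum_tail (e : R) x : 0 < e ->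
  exists2 r, 0 <= r < 1 & forall n,
  (P [set w | (n%:R * e <= compensated_sum n w x)%R] <= (r ^+ n)%:E)%E.
Proof.
move=> e0.
(* The first bound makes 8 M^2 l^2 <= l e / 2, the second makes
   [compensated_sum_moment] applicable. *)
pose l := Num.min (e / (16 * M ^+ 2)) (4 * M)^-1.
have l0 : 0 < l by rewrite lt_min divr_gt0 ?invr_gt0 ?mulr_gt0 ?exprn_gt0.
have l1 : l * (16 * M ^+ 2) <= e.
  by rewrite -ler_pdivlMr ?mulr_gt0 ?exprn_gt0// ge_min lexx.
have l2 : `|l| * (2 * M) <= 2^-1.
  rewrite gtr0_norm//; have : l * (4 * M) <= 1; last by lra.
  by rewrite -ler_pdivlMr ?mulr_gt0// div1r ge_min lexx orbT.
exists (expR (8 * M ^+ 2 * l ^+ 2 - l * e)).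
  rewrite expR_ge0 expR_lt1 subr_lt0.
  have -> : 8 * M ^+ 2 * l ^+ 2 = l * (l * (16 * M ^+ 2)) / 2 by rewrite expr2; field.
  rewrite ltr_pdivrMr// -mulrA ltr_pM2l//; lra.
move=> n; set E := [set w | _].
have mS := measurable_compensated_sum n x.
have mE : measurable E.
  rewrite /E (_ : [set w | _] =
     setT `&` (fun w => compensated_sum n w x) @^-1` `[n%:R * e, +oo[).
    exact: mS.
  by apply/seteqP; split => w /=; rewrite in_itv/= andbT => // -[].
have mexp : measurable_fun setT
    (fun w => (expR (l * compensated_sum n w x))%:E).
  apply/measurable_EFinP; apply: measurableT_comp => //.
  exact: measurable_funM.
have lo : ((expR (l * (n%:R * e)))%:E * P E <=
    \int[P]_w (expR (l * compensated_sum n w x))%:E)%E.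
  rewrite -integral_cst//.
  apply: (@le_trans _ _ (\int[P]_(w in E) (expR (l * compensated_sum n w x))%:E)%E).
    apply: ge0_le_integral => //.
    - by move=> w _; rewrite lee_fin expR_ge0.
    - exact: measurable_funTS.
    - by move=> w /= Ew; rewrite lee_fin ler_expR ler_pM2l.
  by apply: ge0_subset_integral.
have := le_trans lo (compensated_sum_moment n x l2).
rewrite -[P E]fineK ?fin_num_measure// -EFinM !lee_fin -expRM_natl.
rewrite -ler_pdivlMl ?expR_gt0// => /le_trans; apply.
by rewrite -expRN -expRD ler_expR le_eqVlt; apply/orP; left; apply/eqP; ring.
Qed.

Lemma ae_compensated_sum_le (e : R) x : 0 < e ->
  {ae P, forall w, \forall n \near \oo, compensated_sum n w x < n%:R * e}.
Proof.
move=> e0; have [r r01 Hr] := compensated_sum_tail x e0.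
have mS := measurable_compensated_sum.
have mE n : measurable [set w | n%:R * e <= compensated_sum n w x].
  rewrite (_ : [set w | _] =
     setT `&` (fun w => compensated_sum n w x) @^-1` `[n%:R * e, +oo[).
    exact: mS.
  by apply/seteqP; split => w /=; rewrite in_itv/= andbT => // -[].
apply: filterS (ae_eventually mE r01 Hr) => w; apply: filterS => n /=.
by rewrite ltNge => /negP.
Qed.

End martingale.

Section strong_law.
Variables (phi psi : X -> R) (M : R).
Hypotheses (mphi : measurable_fun setT phi) (mpsi : measurable_fun setT psi).
Hypotheses (M0 : 0 < M) (phiM : forall x, `|phi x| <= M).
Hypothesis psiE : forall x, \int[p]_t phi (f t x) = psi x.

(** Replacing phi (x_(j+1)) by phi (x_j) in the martingale changes the sum
   only by two boundary terms, so the averages of phi - psi tend to 0 with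
   those of the martingale. *)
Lemma orbit_average_defect x :
  {ae P, forall w, n%:R^-1 * \sum_(0 <= j < n)
     (phi (random_orbit f w x j) - psi (random_orbit f w x j)) @[n --> \oo]
     --> (0 : R)}.
Proof.
have up := fun k : nat => ae_compensated_sum_le mphi mpsi M0 phiM psiE x
  (e := k.+1%:R^-1) ltac:(by rewrite invr_gt0).
have NphiM z : `|- phi z| <= M by rewrite normrN.
have NpsiE z : \int[p]_t (- phi (f t z)) = - psi z.
  under eq_Rintegral do rewrite -mulN1r.
  rewrite RintegralZl// ?psiE ?mulN1r//.
  apply: (@bounded_integrable _ _ _ _ _ M) => //.
  by apply: measurableT_comp => //; exact: measurable_fun_pair1 mf.
have lo := fun k : nat => ae_compensated_sum_le (measurable_funN mphi)
  (measurable_funN mpsi) M0 NphiM NpsiE x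
  (e := k.+1%:R^-1) ltac:(by rewrite invr_gt0).
move/ae_foralln: up => up; move/ae_foralln: lo => lo.
apply: filterS2 up lo => w upw low.
have tele n : \sum_(0 <= j < n)
     (phi (random_orbit f w x j) - psi (random_orbit f w x j)) =
  compensated_sum phi psi n w x - phi (random_orbit f w x n) + phi x.
  rewrite big_mkord /compensated_sum; elim: n => [|n ih].
    by rewrite !big_ord0 sub0r addNr.
  by rewrite !big_ord_recr/= ih; ring.
have opp n : compensated_sum (\- phi) (\- psi) n w x =
    - compensated_sum phi psi n w x.
  by rewrite /compensated_sum -sumrN; apply: eq_bigr => i _; rewrite opprD.
apply/cvgrPdist_le => e e0.
pose k := Num.truncn (2 / e).
have ke : k.+1%:R^-1 < e / 2.
  by rewrite -[ltRHS]invf_div ltf_pV2 ?posrE ?divr_gt0// truncnS_gt.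
near=> n.
have n0 : 0 < n%:R :> R by rewrite ltr0n; near: n; exact: nbhs_infty_gt.
have nM : 2 * M <= n%:R * (e / 2).
  by rewrite -ler_pdivrMr ?divr_gt0//; near: n; exact: nbhs_infty_ger.
rewrite sub0r normrN normrM gtr0_norm ?invr_gt0// ler_pdivrMl// tele.
have S1 : compensated_sum phi psi n w x < n%:R / k.+1%:R.
  by near: n; exact: upw.
have S2 : - compensated_sum phi psi n w x < n%:R / k.+1%:R.
  by rewrite -opp; near: n; exact: low.
have ken : n%:R / k.+1%:R <= n%:R * (e / 2) by rewrite ler_pM2l// ltW.
have := phiM x; have := phiM (random_orbit f w x n).
rewrite !ler_norml => /andP[h1 h2] /andP[h3 h4].
have -> : n%:R * e = n%:R * (e / 2) + n%:R * (e / 2) by rewrite -mulrDr -splitr.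
have := lt_le_trans S1 ken; have := lt_le_trans S2 ken; move: nM h1 h2 h3 h4.
move: (n%:R * (e / 2)) (compensated_sum _ _ _ _ _) (phi _) (phi x) => a S y z.
move=> nM h1 h2 h3 h4 S2' S1'; apply/andP; split; lra.
Unshelve. all: by end_near. Qed.

End strong_law.
End orbits.

(** * Riesz representation on the circle *)

(** When b switches from false to true once, the telescoping weights b (i + 1)
   - b i select the value of c at the switch. This evaluates step functions
   both in the angle and in the quantile variable. *)
Lemma step_value (R : realType) (b : nat -> bool) (c : nat -> R) (n : nat) :
  ~~ b 0%N -> b n.+1 -> (forall i, (i <= n)%N -> b i -> b i.+1) ->
  exists j, [/\ (j <= n)%N, ~~ b j, b j.+1 &
    \sum_(i < n.+1) c i * ((b i.+1)%:R - (b i)%:R) = c j].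
Proof.
move=> b0; elim: n => [|n ih] bn bS.
  by exists 0%N; rewrite big_ord1 bn (negbTE b0) subr0 mulr1.
have [bn'|bn'] := boolP (b n.+1).
  have [i ip|j [jn bj bj1 jE]] := ih bn'; first by apply: bS; exact: leqW.
  exists j; split => //; first exact: leqW.
  by rewrite big_ord_recr/= jE bn bn' subrr mulr0 addr0.
exists n.+1; split => //.
rewrite big_ord_recr/= bn (negbTE bn') subr0 mulr1 big1 ?add0r// => i _.
have nb k : (k <= n.+1)%N -> ~~ b k.
  move=> kn; have [d] : {d | (k + d = n.+1)%N} by exists (n.+1 - k)%N; lia.
  elim: d k kn => [k kn|d ihd k kn kd]; first by rewrite addn0 => ->.
  have kn' : (k.+1 <= n.+1)%N by lia.
  by apply: contra (ihd _ kn' _); [exact: bS|lia].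
by rewrite !(negbTE (nb _ _)) ?subrr ?mulr0//; have := ltn_ord i; lia.
Qed.

Lemma Rintegral_sum d (X : measurableType d) (R : realType)
    (mu : probability X R) (c : nat -> R) (h : nat -> X -> R) (M : R) (n : nat) :
  (forall i, measurable_fun setT (h i)) -> (forall i x, `|h i x| <= M) ->
  \int[mu]_x (\sum_(i < n) c i * h i x) = \sum_(i < n) c i * \int[mu]_x h i x.
Proof.
move=> mh hM.
have mch i : measurable_fun setT (fun x => c i * h i x).
  by apply: measurable_funM => //; exact: mh.
have ich i : mu.-integrable setT (EFin \o (fun x => c i * h i x)).
  apply: (@bounded_integrable _ _ _ _ _ (`|c i| * M)) => // x.
  by rewrite normrM ler_wpM2l.
elim: n => [|n ih].
  by under eq_Rintegral do rewrite big_ord0; rewrite big_ord0 Rintegral_prob_cst.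
under eq_Rintegral do rewrite big_ord_recr/=.
rewrite RintegralD// ?ih.
  by rewrite RintegralZl ?big_ord_recr//; exact: bounded_integrable (mh n) (hM n).
apply: (@bounded_integrable _ _ _ _ _ (\sum_(i < n) `|c i| * M)).
  exact: measurable_sum.
move=> x; rewrite (le_trans (ler_norm_sum _ _ _))// ler_sum// => i _.
by rewrite normrM ler_wpM2l.
Qed.

Section riesz_circle.
Context (R : realType).
Local Notation C := (circle R).
Variable L : (C -> R) -> R.
Definition bounded_real (h : C -> R) := exists M, forall z, `|h z| <= M.
Hypothesis L_linear : forall a h k, bounded_real h -> bounded_real k ->
  L (fun z => a * h z + k z) = a * L h + L k.
Hypothesis L_ge0 : forall h, bounded_real h -> (forall z, 0 <= h z) -> 0 <= L h.
Hypothesis L_one : L (fun=> 1) = 1.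

Let bounded_lin a h k : bounded_real h -> bounded_real k ->
  bounded_real (fun z => a * h z + k z).
Proof.
move=> [M hM] [N kN]; exists (`|a| * M + N) => z.
by rewrite (le_trans (ler_normD _ _))// lerD// normrM ler_wpM2l.
Qed.

Let bounded_cst a : bounded_real (fun=> a).
Proof. by exists `|a|. Qed.

Lemma functional_cst a : L (fun=> a) = a.
Proof.
have /= := @L_linear (a - 1) (fun=> 1) (fun=> 1) (bounded_cst 1) (bounded_cst 1).
by rewrite L_one mulr1 subrK.
Qed.

Lemma functional_sub h k : bounded_real h -> bounded_real k ->
  L (fun z => h z - k z) = L h - L k.
Proof.
move=> bh bk; rewrite -mulN1r addrC -L_linear//; congr L.
by apply/funext => z; rewrite mulN1r addrC.
Qed.

Lemma functional_le h k : bounded_real h -> bounded_real k ->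
  (forall z, h z <= k z) -> L h <= L k.
Proof.
move=> bh bk hk; rewrite -subr_ge0 -functional_sub//.
apply: L_ge0; last by move=> z; rewrite subr_ge0.
have [M kM] := bounded_lin (-1) bh bk.
by exists M => z; rewrite addrC -mulN1r.
Qed.

(** Positivity makes L a contraction for the uniform norm. *)
Lemma functional_dist h k e : bounded_real h -> bounded_real k ->
  (forall z, `|h z - k z| <= e) -> `|L h - L k| <= e.
Proof.
move=> bh bk hk; have bsub : bounded_real (fun z => h z - k z).
  by exists e.
rewrite -functional_sub// ler_norml; apply/andP; split.
  rewrite -[leLHS]functional_cst functional_le// => z.
  by have := hk z; rewrite ler_norml => /andP[].
rewrite -[leRHS]functional_cst functional_le// => z.
by have := hk z; rewrite ler_norml => /andP[].
Qed.

Lemma functional_sum (c : nat -> R) (h : nat -> C -> R) (n : nat) :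
  (forall i, bounded_real (h i)) ->
  bounded_real (fun z => \sum_(i < n) c i * h i z) /\
  L (fun z => \sum_(i < n) c i * h i z) = \sum_(i < n) c i * L (h i).
Proof.
move=> bh; elim: n => [|n [bn ih]].
  under eq_fun do rewrite big_ord0.
  by rewrite big_ord0 functional_cst; split => //; exact: bounded_cst.
have e : (fun z => \sum_(i < n.+1) c i * h i z) =
    (fun z => c n * h n z + \sum_(i < n) c i * h i z).
  by apply/funext => z; rewrite big_ord_recr/= addrC.
by rewrite e L_linear// ih big_ord_recr/= addrC; split => //; exact: bounded_lin.
Qed.

Definition arg_lt (t : R) (z : C) : R := ((circle_arg z < t)%R)%:R.

Definition arg_cdf t := L (arg_lt t).

Lemma bounded_arg_lt t : bounded_real (arg_lt t).
Proof. by exists 1 => z; rewrite /arg_lt; case: ltP; rewrite ?normr1 ?normr0. Qed.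

Lemma arg_cdf_le s t : s <= t -> arg_cdf s <= arg_cdf t.
Proof.
move=> st; apply: functional_le => [||z]; [exact: bounded_arg_lt..|].
by rewrite /arg_lt ler_nat; case: (ltP _ s) => // /lt_le_trans/(_ st) ->.
Qed.

Lemma arg_cdf0 : arg_cdf 0 = 0.
Proof.
rewrite -[RHS](functional_cst 0); congr L; apply/funext => z.
by rewrite /arg_lt ltNge; have /andP[-> _] := circle_arg_itv z.
Qed.

Lemma arg_cdf1 : arg_cdf 1 = 1.
Proof.
rewrite -[RHS](functional_cst 1); congr L; apply/funext => z.
by rewrite /arg_lt; have /andP[_ ->] := circle_arg_itv z.
Qed.

Definition quantile_set (u : R) := [set t | 0 <= t <= 1 /\ arg_cdf t <= u].

(** The quantile function of the distribution function of the angle under L.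
   Pushing Lebesgue measure forward by it gives a countably additive measure
   at once, whereas L itself is only finitely additive on sets. *)
Definition quantile (u : R) := sup (quantile_set u).

Let quantile_set_ubound u : has_ubound (quantile_set u).
Proof. by exists 1 => t [/andP[]]. Qed.

Lemma quantile_le1 u : quantile u <= 1.
Proof.
rewrite /quantile.
have [->|/set0P q0] := eqVneq (quantile_set u) set0; first by rewrite sup0.
by apply: ge_sup => // t [/andP[]].
Qed.

Lemma quantile_ge u t : 0 <= t <= 1 -> arg_cdf t <= u -> t <= quantile u.
Proof. by move=> t01 tu; apply: (ub_le_sup (quantile_set_ubound u)). Qed.

Lemma quantile_ge0 u : 0 <= quantile u.
Proof.
rewrite /quantile; have [->|/set0P[t [t01 tu]]] := eqVneq (quantile_set u) set0.
  by rewrite sup0.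
by apply: le_trans (quantile_ge t01 tu); have /andP[] := t01.
Qed.

Lemma quantile_le u t : 0 <= t -> u < arg_cdf t -> quantile u <= t.
Proof.
move=> t0 ut; rewrite /quantile.
have [->|/set0P q0] := eqVneq (quantile_set u) set0; first by rewrite sup0.
apply: ge_sup => // s [_ su]; rewrite leNgt; apply/negP => /ltW /arg_cdf_le ts.
by move: (lt_le_trans ut (le_trans ts su)); rewrite ltxx.
Qed.

Lemma quantile_nondecreasing : {homo quantile : u v / u <= v}.
Proof.
move=> u v uv; rewrite {1}/quantile.
have [->|/set0P q0] := eqVneq (quantile_set u) set0.
  by rewrite sup0 quantile_ge0.
apply: ge_sup => // s [s01 su]; apply: quantile_ge => //.
exact: le_trans uv.
Qed.

Definition quantile_map (u : measurableTypeR R) : C := circle_exp (quantile u).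

Lemma measurable_quantile_map : measurable_fun setT quantile_map.
Proof.
apply: (measurableT_comp (@circle_exp_measurable R)).
by apply: nondecreasing_measurable => // u v; exact: quantile_nondecreasing.
Qed.

Definition unit_uniform : probability (measurableTypeR R) R :=
  uniform_prob (@ltr01 R).

Definition riesz_measure : probability C R :=
  image_probability measurable_quantile_map unit_uniform.


Lemma uniform_prob_lt (a : R) : 0 <= a <= 1 ->
  unit_uniform [set u | u < a] = a%:E.
Proof.
move=> /andP[a0 a1]; rewrite /unit_uniform/= /uniform_prob integral_uniform_pdf.
rewrite (_ : _ `&` _ = `[0, a[%classic); last first.
  apply/seteqP; split => u /=; rewrite !in_itv/=.
    by move=> [ua /andP[-> _]].
  by move=> /andP[u0 ua]; rewrite ua u0 (ltW (lt_le_trans ua a1)).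
rewrite (eq_integral (cst 1%E)); last first.
  move=> u /set_mem/=; rewrite in_itv/= => /andP[u0 ua].
  by rewrite /uniform_pdf u0 (ltW (lt_le_trans ua a1)) subr0 invr1.
rewrite integral_cst//= mul1e lebesgue_measure_itv/= lte_fin oppr0 adde0.
by move: a0; rewrite le_eqVlt => /orP[/eqP <-|->//]; rewrite ltxx.
Qed.

(** Both sides are compared with the Riemann sum of psi over a fine regular
   subdivision t_i, weighted by the increments of [arg_cdf]. For L this is the
   approximation of psi by a step function of the angle. For the integral, the
   quantile u lands in the closed interval [t_j, t_(j+1)] when arg_cdf t_j <=
   u < arg_cdf t_(j+1); closed intervals suffice because psi is continuous, so
   the t_i need not be continuity points of the distribution function. *)
Theorem riesz_representation (psi : C -> R) : continuous psi ->
  \int[riesz_measure]_z psi z = L psi.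
Proof.
move=> psic; have [M M0 psiM] := circle_continuous_bounded psic.
have mpsi := circle_continuous_measurable psic.
have bpsi : bounded_real psi by exists M.
pose mu := unit_uniform.
have mq := measurable_quantile_map.
have mpq : measurable_fun setT (psi \o quantile_map) by exact: measurableT_comp.
have intE : \int[riesz_measure]_z psi z = \int[mu]_u psi (quantile_map u).
  rewrite /Rintegral /riesz_measure /image_probability integral_distribution//.
    by apply/measurable_EFinP.
  by apply: (@bounded_integrable _ _ _ _ (psi \o quantile_map) M) => // u; exact: psiM.
suff H e : 0 < e -> `|\int[riesz_measure]_z psi z - L psi| <= e.
  apply/eqP; rewrite -subr_eq0 -normr_eq0 eq_le normr_ge0 andbT.
  by apply/ler_addgt0Pr => e e0; rewrite add0r; exact: H.
move=> e0.
have e20 : 0 < e / 2 by rewrite divr_gt0.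
have [n Hn] := circle_exp_unif_continuous psic e20.
pose t (i : nat) : R := i%:R / n.+1%:R.
have n0 : 0 < n.+1%:R :> R by rewrite ltr0n.
have t0 : t 0%N = 0 by rewrite /t mul0r.
have t1 : t n.+1 = 1 by rewrite /t divff ?gt_eqF.
have tS i j : (i <= j)%N -> t i <= t j by move=> ij; rewrite ler_pM2r ?invr_gt0 ?ler_nat.
have t01 i : (i <= n.+1)%N -> 0 <= t i <= 1.
  by move=> ilen; rewrite -{1}t0 -t1 !tS.
pose c i := psi (circle_exp (t i)).
have close i s : (i <= n)%N -> t i <= s <= t i.+1 ->
    `|psi (circle_exp s) - c i| <= e / 2.
  move=> lein ts; rewrite distrC ltW//.
  exact: (Hn i s lein ts).
pose sum := \sum_(i < n.+1) c i * (arg_cdf (t i.+1) - arg_cdf (t i)).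
rewrite (splitr e) -(subrKA sum) (le_trans (ler_normD _ _))// lerD//.
- rewrite intE.
  (* The indicators of u < arg_cdf (t i), forced to be false at i = 0 and true
     at i = n + 1, so that [step_value] applies to every real u, also outside
     [0, 1]. *)
  pose b (u : measurableTypeR R) i :=
    (i == n.+1) || ((0 < i)%N && ((u : R) < arg_cdf (t i))).
  pose h i (u : measurableTypeR R) : R := (b u i.+1)%:R - (b u i)%:R.
  have mb i : measurable [set u | b u i].
    rewrite /b; case: eqP => _ /=; first by rewrite (_ : [set _ | _] = setT)//; apply/seteqP.
    case: i => [|i] /=; first by rewrite (_ : [set _ | _] = set0)//; apply/seteqP; split.
    have -> : [set u | u < arg_cdf (t i.+1)] = `]-oo, (arg_cdf (t i.+1))[%classic.
      by apply/seteqP; split => u; rewrite /= in_itv.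
    exact: measurable_itv.
  have bI i u : (b u i)%:R = \1_[set u | b u i] u :> R.
    by rewrite indicE; congr ((nat_of_bool _)%:R); apply/idP/idP => [?|/set_mem//]; exact/mem_set.
  have mI i : measurable_fun setT (fun u => (b u i)%:R : R).
    rewrite (_ : (fun u => _) = \1_[set u | b u i]); first exact: measurable_indic.
    exact/funext/bI.
  have bi1 i u : `|(b u i)%:R : R| <= 1 by case: (b u i); rewrite ?normr1 ?normr0.
  have iI i : (i <= n.+1)%N -> \int[mu]_u ((b u i)%:R : R) = arg_cdf (t i).
    move=> ilen; under eq_Rintegral do rewrite bI.
    have -> : \int[mu]_u (\1_[set u | b u i] u : R) = fine (mu [set u | b u i]).
      rewrite /Rintegral integral_indic//; congr (fine (mu _)).
      by apply/seteqP; split => [u []|u bu] //; split.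
    have [->|in1] := eqVneq i n.+1.
      rewrite t1 arg_cdf1 (_ : [set u | _] = setT) ?measure_probT//.
      by apply/seteqP; split => // u _; rewrite /= /b eqxx.
    case: i in1 ilen => [_ _|i in1 ilen].
      by rewrite t0 arg_cdf0 (_ : [set u | _] = set0) ?measure0//;
        apply/seteqP; split.
    rewrite (_ : [set u | _] = [set u | u < arg_cdf (t i.+1)]).
      rewrite uniform_prob_lt// -arg_cdf0 -[X in _ <= _ <= X]arg_cdf1.
      by have /andP[? ?] := t01 _ ilen; rewrite !arg_cdf_le.
    by apply/seteqP; split => u; rewrite /= /b (negbTE in1).
  have hE : sum = \int[mu]_u \sum_(i < n.+1) c i * h i u.
    rewrite (@Rintegral_sum _ _ _ _ _ _ 2).
    + apply: eq_bigr => i _; congr (_ * _); rewrite /h RintegralB ?iI//.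
      * by apply: leqW; rewrite -ltnS.
      * by apply: (@bounded_integrable _ _ _ _ _ 1); [exact: mI|exact: bi1].
      * by apply: (@bounded_integrable _ _ _ _ _ 1); [exact: mI|exact: bi1].
    + by move=> i; apply: measurable_funB; exact: mI.
    + by move=> i u; rewrite (le_trans (ler_normB _ _))// -[2]/(1 + 1) lerD.
  have msum : measurable_fun setT (fun u => \sum_(i < n.+1) c i * h i u).
    apply: measurable_sum => i; apply: measurable_funM => //.
    by apply: measurable_funB; exact: mI.
  have pt u : `|psi (quantile_map u) - \sum_(i < n.+1) c i * h i u| <= e / 2.
    have [||i lein|j [jn bj bj1 ->]] := @step_value R (b u) c n.
    + by [].
    + by rewrite /b eqxx.
    + have /negbTE in1 : i != n.+1 by lia.
      rewrite /b in1/= => /andP[i0 ui].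
      by apply/orP; right; apply: lt_le_trans ui _; apply: arg_cdf_le; exact: tS.
    apply: close => //; apply/andP; split.
      move: bj; rewrite /b negb_or => /andP[_].
      case: (posnP j) => [->|j0]; first by rewrite t0 quantile_ge0.
      rewrite /= -leNgt => gu; apply: quantile_ge => //.
      by apply: t01; exact: leqW.
    move: bj1; rewrite /b => /orP[/eqP ->|/andP[_ ug]].
      by rewrite t1 quantile_le1.
    by apply: quantile_le => //; have /andP[] := t01 j.+1 jn.
  rewrite hE -RintegralB//.
  + apply: Rintegral_bounded => //.
    exact: measurable_funB.
  + by apply: (@bounded_integrable _ _ _ _ (psi \o quantile_map) M) => // u; exact: psiM.
  + apply: (@bounded_integrable _ _ _ _ _ (M + e / 2)) => // u.
    rewrite -[X in `|X|](subrK (psi (quantile_map u))) addrC (le_trans (ler_normD _ _))//.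
    by rewrite lerD// distrC.
- rewrite distrC.
  pose h i z := arg_lt (t i.+1) z - arg_lt (t i) z.
  have bh i : bounded_real (h i).
    exists 2 => z; rewrite (le_trans (ler_normB _ _))// -[2]/(1 + 1) lerD//.
      by rewrite /arg_lt; case: ltP; rewrite ?normr1 ?normr0.
    by rewrite /arg_lt; case: ltP; rewrite ?normr1 ?normr0.
  have [bsum sumE] := functional_sum c n.+1 bh.
  have -> : sum = L (fun z => \sum_(i < n.+1) c i * h i z).
    rewrite sumE; apply: eq_bigr => i _; congr (_ * _).
    by rewrite /h functional_sub//; exact: bounded_arg_lt.
  apply: functional_dist => // z.
  have [||i lein|j [jn bj bj1 ->]] := @step_value R (fun i => circle_arg z < t i) c n.
  + by rewrite t0 -leNgt; have /andP[] := circle_arg_itv z.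
  + by rewrite t1; have /andP[] := circle_arg_itv z.
  + by move=> /lt_le_trans; apply; exact: tS.
  rewrite -{1}(circle_argK z); apply: close => //.
  by rewrite leNgt bj ltW.
Qed.

End riesz_circle.

(** * Borel probabilities on the circle are determined by continuous functions *)

Section inner_approximation.
Context (R : realType).
Implicit Types (U : set (circle R)) (z : circle R).

(** Continuous approximation of the indicator function of an open set U from
   inside: only the bumps supported in U are kept. *)
Definition inner n U z : R :=
  \sum_(i < size (@net R n) | `[< ball (nth point (net R n) i) n.+1%:R^-1 `<=` U >])
    partition_unity n i z.

Lemma inner_continuous n U : continuous (inner n U).
Proof.
apply: continuous_big => [|i _]; first exact: add_continuous.
exact: partition_unity_continuous.
Qed.

Lemma inner_ge0 n U z : 0 <= inner n U z.
Proof. by apply: sumr_ge0 => i _; exact: partition_unity_ge0. Qed.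

Lemma inner_le1 n U z : inner n U z <= 1.
Proof.
rewrite -(partition_unity_sum n z) /inner [leRHS](bigID
  (fun i : 'I__ => `[< ball (nth point (net R n) i) n.+1%:R^-1 `<=` U >]))/=.
by rewrite lerDl; apply: sumr_ge0 => i _; exact: partition_unity_ge0.
Qed.

Lemma inner_norm_le1 n U z : `|inner n U z| <= 1.
Proof. by rewrite ger0_norm ?inner_ge0 ?inner_le1. Qed.

Lemma inner_out n U z : ~ U z -> inner n U z = 0.
Proof.
move=> Uz; apply: big1 => i /asboolP sU; apply/eqP; apply: contrapT => /negP p0.
by apply: Uz; apply: sU; exact: partition_unity_support.
Qed.

Lemma inner_cvg U z : open U -> inner n U z @[n --> \oo] --> (\1_U z : R).
Proof.
move=> Uo; rewrite indicE.
have [Uz|Uz] := pselect (U z); last first.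
  rewrite memNset//; under eq_fun do rewrite inner_out//.
  exact: cvg_cst.
rewrite mem_set//; apply/cvgrPdist_le => e e0.
have /nbhs_ballP[r /= r0 rU] : nbhs z U by exact: open_nbhs_nbhs.
have r20 : 0 < r / 2 by rewrite divr_gt0.
near=> n.
have nr : n.+1%:R^-1 <= r / 2.
  by apply/ltW; near: n; exact: (near_infty_natSinv_lt (PosNum r20)).
suff -> : inner n U z = 1 by rewrite subrr normr0 ltW.
rewrite -(partition_unity_sum n z) /inner [RHS](bigID
  (fun i : 'I__ => `[< ball (nth point (net R n) i) n.+1%:R^-1 `<=` U >]))/=.
rewrite [X in _ = _ + X]big1 ?addr0// => i /asboolPn sU.
apply/eqP; apply: contrapT => /negP p0; apply: sU => y yi; apply: rU.
have h := partition_unity_support p0.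
apply: (@ball_splitr _ _ (nth point (net R n) i)).
  exact: le_ball h.
exact: le_ball yi.
Unshelve. all: by end_near. Qed.

Lemma integral_inner_cvg (nu : probability (circle R) R) U : open U ->
  (\int[nu]_z (inner n U z)%:E)%E @[n --> \oo] --> nu U.
Proof.
move=> Uo; have mU := circle_open_measurable Uo.
have <- : (\int[nu]_z (\1_U z)%:E)%E = nu U by rewrite integral_indic// setIT.
apply: (@dominated_cvg _ _ _ _ _ measurableT _ _ (cst 1%E)) => //.
- move=> n; apply/measurable_EFinP; apply: circle_continuous_measurable.
  exact: inner_continuous.
- by move=> z _; apply/cvg_EFin; [exact: nearW|exact: inner_cvg].
- exact: (finite_measure_integrable_cst nu 1).
- by move=> n z _ /=; rewrite lee_fin inner_norm_le1.
Qed.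

(** The measure of an open set is the limit of the integrals of its inner
   approximations, and open sets form a pi-system. *)
Lemma circle_measure_ext (nu1 nu2 : probability (circle R) R) :
  (forall phi : circle R -> R, continuous phi ->
     \int[nu1]_z phi z = \int[nu2]_z phi z) ->
  forall A, measurable A -> nu1 A = nu2 A.
Proof.
move=> nu12; apply: (measure_unique (@open (circle R)) (fun=> setT)) => //.
- by move=> A B; exact: openI.
- by move=> i; exact: openT.
- by apply/seteqP; split => // x _; exists 0%N.
- move=> U Uo; have h1 := @integral_inner_cvg nu1 U Uo.
  have h2 := @integral_inner_cvg nu2 U Uo.
  have mi n := circle_continuous_measurable (@inner_continuous n U).
  have ii (nu : probability (circle R) R) n :=
    bounded_integrable nu (mi n) (@inner_norm_le1 n U).
  have e : (fun n => \int[nu1]_z (inner n U z)%:E)%E =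
           (fun n => \int[nu2]_z (inner n U z)%:E)%E.
    apply/funext => n; rewrite !EFin_Rintegral// nu12//.
    exact: inner_continuous.
  by rewrite e in h1; exact: cvg_unique h1 h2.
- by move=> _; exact: (le_lt_trans (probability_le1 nu1 measurableT) (ltry 1)).
Qed.

End inner_approximation.

(** * Limits of averages along an ultrafilter *)

Section ultralimit.
Context (R : realType).

(** A bounded sequence has a cluster point along the ultrafilter, and a
   cluster point of an ultrafilter is a limit. *)
Lemma ultra_bounded_cvg (U : set_system nat) (u : nat -> R) (M : R) :
  UltraFilter U -> (forall n, `|u n| <= M) -> exists l : R, u @ U --> l.
Proof.
move=> UU uM; have PU : ProperFilter U := @ultra_proper _ _ UU.
have [l [_ ul]] : exists l, (`[- M, M]%classic `&` cluster (u @ U)) l.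
  have SB : (u @ U) `[- M, M]%classic.
    apply: (@filterS _ U _ setT _ _ filterT) => n _ /=.
    by rewrite in_itv/= -ler_norml.
  exact: (@segment_compact _ _ _ (u @ U) _ SB).
exists l => V Vl.
have [//|nV] := in_ultra_setVsetC (u @^-1` V) UU.
by have [y []] : (~` V) `&` V !=set0 by exact: ul.
Qed.

Variable x : nat -> circle R.

Definition average (h : circle R -> R) (n : nat) : R :=
  n%:R^-1 * \sum_(0 <= j < n) h (x j).

Lemma average_le h (M : R) n : (forall z, `|h z| <= M) -> `|average h n| <= M.
Proof.
move=> hM; have M0 : 0 <= M by exact: le_trans (hM point).
rewrite /average; case: n => [|n]; first by rewrite invr0 mul0r normr0.
rewrite normrM ger0_norm ?invr_ge0// ler_pdivrMl ?ltr0n//.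
rewrite (le_trans (ler_norm_sum _ _ _))//.
rewrite (le_trans (ler_sum _ (fun i _ => hM (x i))))//.
by rewrite big_mkord sumr_const card_ord mulr_natl.
Qed.

Lemma average_linear a h k n :
  average (fun z => a * h z + k z) n = a * average h n + average k n.
Proof. by rewrite /average big_split/= -mulr_sumr; ring. Qed.

Variable U : set_system nat.
Hypotheses (UU : UltraFilter U) (Uoo : \oo `<=` U).

Let PU : ProperFilter U := @ultra_proper _ _ UU.

(** A generalized limit of averages, meaningful for all bounded functions. It
   replaces the extraction of a weakly convergent subsequence of empirical
   measures. *)
Definition ultralimit (h : circle R -> R) : R := lim (average h @ U).

Lemma ultralimit_cvg h : bounded_real h -> average h @ U --> ultralimit h.
Proof.
move=> [M hM].
have [l ul] := ultra_bounded_cvg UU (fun n => average_le n hM).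
by rewrite /ultralimit (cvg_lim _ ul).
Qed.

Lemma ultralimit_eq h (l : R) : average h @ U --> l -> ultralimit h = l.
Proof. exact: cvg_lim. Qed.

Lemma ultralimit_linear a h k : bounded_real h -> bounded_real k ->
  ultralimit (fun z => a * h z + k z) = a * ultralimit h + ultralimit k.
Proof.
move=> bh bk; apply: ultralimit_eq; under eq_cvg do rewrite average_linear.
apply: cvgD; last exact: ultralimit_cvg.
by apply: cvgM; [exact: cvg_cst|exact: ultralimit_cvg].
Qed.

Lemma ultralimit_ge0 h : bounded_real h -> (forall z, 0 <= h z) ->
  0 <= ultralimit h.
Proof.
move=> bh h0; apply: limr_ge.
  by apply/cvg_ex; exists (ultralimit h); exact: ultralimit_cvg.
by apply: nearW => n; rewrite mulr_ge0 ?invr_ge0 ?sumr_ge0.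
Qed.

Lemma ultralimit_eventually h (l : R) :
  average h n @[n --> \oo] --> l -> ultralimit h = l.
Proof. by move=> hl; apply: ultralimit_eq => V /hl; exact: Uoo. Qed.

Lemma ultralimit_one : ultralimit (fun=> 1) = 1.
Proof.
apply: ultralimit_eventually; apply: cvg_near_cst; near=> n.
have n0 : (0 < n)%N by near: n; exact: nbhs_infty_gt.
rewrite /average big_mkord sumr_const card_ord mulVf// pnatr_eq0; lia.
Unshelve. all: by end_near. Qed.

End ultralimit.

(** * Averages along orbits and stationary measures *)

Section transition_operator.
Context d (T : measurableType d) (R : realType).
Variables (f : T -> circle R -> circle R) (p : probability T R).
Hypotheses (Tfin : finite_set [set: T]) (fc : forall t, continuous (f t)).
Hypothesis mf : measurable_fun setT (fun z : T * circle R => f z.1 z.2).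

Definition transition (phi : circle R -> R) (x : circle R) : R :=
  \int[p]_t phi (f t x).

Let mphif (phi : circle R -> R) x :
  measurable_fun setT phi -> measurable_fun setT (fun t => phi (f t x)).
Proof. by move=> mphi; apply: measurableT_comp => //; exact: measurable_fun_pair1 mf. Qed.

Lemma transition_bounded (phi : circle R -> R) (M : R) : measurable_fun setT phi ->
  (forall z, `|phi z| <= M) -> forall x, `|transition phi x| <= M.
Proof. by move=> mphi phiM x; apply: Rintegral_bounded => //; exact: mphif. Qed.

Lemma transition_sub (phi psi : circle R -> R) (M : R) x :
  measurable_fun setT phi -> measurable_fun setT psi ->
  (forall z, `|phi z| <= M) -> (forall z, `|psi z| <= M) ->
  transition (fun z => phi z - psi z) x = transition phi x - transition psi x.
Proof.
move=> mphi mpsi phiM psiM; rewrite /transition RintegralB//.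
- by apply: (@bounded_integrable _ _ _ _ _ M) => //; exact: mphif.
- by apply: (@bounded_integrable _ _ _ _ _ M) => //; exact: mphif.
Qed.

(** Feller property; the finitely many letters make the continuity of phi (f t
   x) in x uniform in t. *)
Lemma transition_continuous (phi : circle R -> R) : continuous phi -> continuous (transition phi).
Proof.
move=> phic x; have [M M0 phiM] := circle_continuous_bounded phic.
have mphi := circle_continuous_measurable phic.
apply/(@cvgrPdist_le _ _ _ (nbhs x) _ (transition phi)) => e e0.
have close t : nbhs x [set y | `|phi (f t x) - phi (f t y)| <= e].
  have /cvgrPdist_le/(_ e e0) : phi (f t y) @[y --> x] --> phi (f t x).
    exact: (@continuous_comp _ _ _ (f t) phi x (@fc t x) (@phic (f t x))).
  exact.
have /finite_seqP[s sT] := Tfin.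
have close_all : nbhs x
    [set y | forall t, t \in s -> `|phi (f t x) - phi (f t y)| <= e].
  elim: (s) => [|t r ih]; first exact: filterE.
  apply: filterS2 (close t) ih => y tx rx u.
  by rewrite inE => /orP[/eqP ->//|]; exact: rx.
apply: filterS close_all => y H.
rewrite /transition -RintegralB//.
- apply: Rintegral_bounded => [|t].
    by apply: measurable_funB; exact: mphif.
  by apply: H; have : [set: T] t by []; rewrite sT.
- by apply: (@bounded_integrable _ _ _ _ _ M) => //; exact: mphif.
- by apply: (@bounded_integrable _ _ _ _ _ M) => //; exact: mphif.
Qed.

(** The right-hand side of the stationarity equation is the image of p x nu
   under (t, x) |-> f t x, a probability; by Fubini it integrates a continuous
   phi to the nu-integral of its transition. *)
Lemma stationary_of_transition (nu : probability (circle R) R) :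
  (forall phi : circle R -> R, continuous phi ->
     \int[nu]_x transition phi x = \int[nu]_x phi x) -> stationary f p nu.
Proof.
move=> nuE; pose nu' := image_probability mf (p \x nu)%E.
suff H : forall A, measurable A -> nu' A = nu A.
  move=> A mA; rewrite -H//; apply: eq_integral => t _ /=.
  by rewrite xsectionE.
apply: circle_measure_ext => phi phic.
have [M M0 phiM] := circle_continuous_bounded phic.
have mphi := circle_continuous_measurable phic.
have mcomp : measurable_fun setT (fun z : T * circle R => phi (f z.1 z.2)).
  exact: measurableT_comp mphi mf.
have icomp : (p \x nu)%E.-integrable setT
    (EFin \o (fun z : T * circle R => phi (f z.1 z.2))).
  by apply: (@bounded_integrable _ _ _ _ _ M).
rewrite -nuE// /Rintegral /nu' integral_distribution//; last first.
  exact/measurable_EFinP.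
rewrite -(integral21_prod_meas1 icomp); congr fine.
apply: eq_integral => x _; rewrite /fubini_G/= /transition EFin_Rintegral//.
by apply: (@bounded_integrable _ _ _ _ _ M) => //; exact: mphif.
Qed.

Variable mu : probability (circle R) R.
Hypothesis mu_stat : unique_stationary f p mu.

(** The deterministic half of Breiman's theorem. Failure of convergence yields
   an ultrafilter along which the averages of phi stay away from its
   mu-integral. The hypothesis extends from the partitions of unity to all
   continuous functions by density, so the measure representing the
   generalized limit is stationary, hence equal to mu: a contradiction. *)
Lemma average_cvg_of_defect (x : nat -> circle R) :
  (forall n i, average x (fun z => partition_unity n i z -
     transition (partition_unity n i) z) k @[k --> \oo] --> (0 : R)) ->
  forall phi : circle R -> R, continuous phi ->
  average x phi k @[k --> \oo] --> \int[mu]_z phi z.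
Proof.
move=> defect phi phic; apply: contrapT => ncvg.
have [e e0 He] : exists2 e : R, 0 < e &
    ~ (\forall k \near \oo, `|\int[mu]_z phi z - average x phi k| <= e).
  apply: contrapT => H; apply: ncvg; apply/cvgrPdist_le => e e0.
  by apply: contrapT => He; apply: H; exists e.
(* Every ultrafilter containing the trace of the neighbourhoods of infinity on
   this set witnesses the failure. *)
pose far := [set k | ~ `|\int[mu]_z phi z - average x phi k| <= e].
have Pfar : ProperFilter (within far \oo).
  apply: Build_ProperFilter => farF; apply: He.
  have {}farF : \forall k \near \oo, ~ far k := farF.
  by apply: filterS farF => k H; apply: contrapT => /H.
have [U [UU Ufar]] := ultraFilterLemma Pfar.
have Uoo : \oo `<=` U.
  by move=> A Aoo; apply: Ufar; exact: cvg_within Aoo.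
have Uf : U far by apply: Ufar; apply: withinT.
pose L := ultralimit x U.
have Llin := ultralimit_linear x UU.
have Lge0 := ultralimit_ge0 x UU.
have L1 := ultralimit_one x UU Uoo.
rewrite -/L in Llin Lge0 L1.
pose nu := riesz_measure L.
have Ldefect (psi : circle R -> R) : continuous psi -> L (fun z => psi z - transition psi z) = 0.
  move=> psic; have [N N0 psiN] := circle_continuous_bounded psic.
  have mpsi := circle_continuous_measurable psic.
  apply/eqP; rewrite -normr_le0; apply/ler_addgt0Pr => e' e'0; rewrite add0r.
  have e'2 : 0 < e' / 2 by rewrite divr_gt0.
  have [n Hn] := partition_unity_approx psic e'2.
  pose c i := psi (nth point (net R n) i).
  pose psi' z := \sum_(i < size (net R n)) c i * partition_unity n i z.
  pose h i z := partition_unity n i z - transition (partition_unity n i) z.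
  have bh i : bounded_real (h i).
    exists (1 + 1) => z; rewrite (le_trans (ler_normB _ _))// lerD//.
      exact: partition_unity_norm_le1.
    apply: transition_bounded => [|w]; last exact: partition_unity_norm_le1.
    by apply: circle_continuous_measurable; exact: partition_unity_continuous.
  have [bsum sumE] := functional_sum Llin L1 c (size (net R n)) bh.
  have sum0 : L (fun z => \sum_(i < size (net R n)) c i * h i z) = 0.
    rewrite sumE big1// => i _.
    by rewrite (_ : L (h i) = 0) ?mulr0//; exact: ultralimit_eventually (defect n i).
  have mpsi' : measurable_fun setT psi'.
    apply: measurable_sum => i; apply: measurable_funM => //.
    by apply: circle_continuous_measurable; exact: partition_unity_continuous.
  have psi'N z : `|psi' z| <= N + e' / 2.
    rewrite -[psi' z](subrK (psi z)) addrC (le_trans (ler_normD _ _))// lerD//.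
    by rewrite distrC; exact: Hn.
  have psi'E z : transition psi' z = 
      \sum_(i < size (net R n)) c i * transition (partition_unity n i) z.
    rewrite /transition (@Rintegral_sum _ _ _ _ _
      (fun i t => partition_unity n i (f t z)) 1)// => i.
      apply: mphif; apply: circle_continuous_measurable.
      exact: partition_unity_continuous.
    by move=> t; exact: partition_unity_norm_le1.
  rewrite -[X in `|X|]subr0 -sum0; apply: functional_dist => //.
    exists (N + N) => z; rewrite (le_trans (ler_normB _ _))// lerD//.
    exact: transition_bounded.
  move=> z.
  have -> : \sum_(i < size (net R n)) c i * h i z = psi' z - transition psi' z.
    by rewrite psi'E -sumrB; apply: eq_bigr => i _; rewrite mulrBr.
  have -> : psi z - transition psi z - (psi' z - transition psi' z) =
      (psi z - psi' z) - (transition psi z - transition psi' z) by ring.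
  rewrite (splitr e') (le_trans (ler_normB _ _))// lerD//.
  rewrite -(@transition_sub _ _ (N + e' / 2))//.
    apply: transition_bounded => //; exact: measurable_funB.
  by move=> w; rewrite (le_trans (psiN w))// lerDl ltW.
have nu_stat : stationary f p nu.
  apply: stationary_of_transition => psi psic.
  rewrite !riesz_representation//; last exact: transition_continuous.
  have [N N0 psiN] := circle_continuous_bounded psic.
  have mpsi := circle_continuous_measurable psic.
  apply/esym/eqP; rewrite -subr_eq0 -(functional_sub Llin); first exact/eqP/Ldefect.
    by exists N.
  by exists N; exact: transition_bounded.
have Lphi : L phi = \int[mu]_z phi z.
  rewrite -(riesz_representation Llin Lge0 L1 phic) /Rintegral; congr fine.
  by apply: eq_measure_integral => A mA _; exact: mu_stat.2.
have bphi : bounded_real phi.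
  by have [N N0 phiN] := circle_continuous_bounded phic; exists N.
have /cvgrPdist_le/(_ e e0) := ultralimit_cvg (x := x) UU bphi.
rewrite -/L Lphi => Hnear.
have PU : ProperFilter U := @ultra_proper _ _ UU.
by have [k [+ /=]] := filter_ex (filterI Uf Hnear).
Qed.

End transition_operator.

(** * Basins of the unique stationary measure *)

Section empirical.
Context (R : realType) d (T : measurableType d).
Variable f : T -> circle R -> circle R.

Lemma ge0_integral_empirical w x n (h : circle R -> R) :
  measurable_fun setT h -> (forall z, 0 <= h z) ->
  (\int[empirical_measure f w x n]_z (h z)%:E =
   (average (random_orbit f w x) h n)%:E)%E.
Proof.
move=> mh h0; have mhE : measurable_fun setT (EFin \o h) by exact/measurable_EFinP.
rewrite ge0_integral_mscale//; last by move=> z _; rewrite lee_fin.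
rewrite ge0_integral_measure_sum//; last by move=> z _; rewrite lee_fin.
rewrite /average EFinM big_mkord -sumEFin; congr (_ * _)%E.
apply: eq_bigr => j _; rewrite integral_dirac// ?diracT ?mul1e//.
Qed.

Lemma Rintegral_empirical w x n (phi : circle R -> R) : continuous phi ->
  \int[empirical_measure f w x n]_z phi z = average (random_orbit f w x) phi n.
Proof.
move=> phic; have [M M0 phiM] := circle_continuous_bounded phic.
have mphi := circle_continuous_measurable phic.
have m1 : measurable_fun setT (fun z => phi z + M) by exact: measurable_funD.
have p1 z : 0 <= phi z + M.
  by have := phiM z; rewrite ler_norml => /andP[+ _]; rewrite -subr_ge0 opprK.
have int (h : circle R -> R) : measurable_fun setT h -> (forall z, 0 <= h z) ->
    (empirical_measure f w x n).-integrable setT (EFin \o h).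
  move=> mh h0; apply/integrableP; split; first exact/measurable_EFinP.
  under eq_integral do rewrite /= ger0_norm//.
  by rewrite ge0_integral_empirical// ltry.
have -> : \int[empirical_measure f w x n]_z phi z =
    \int[empirical_measure f w x n]_z ((phi z + M) - M).
  by apply: eq_Rintegral => z _; rewrite addrK.
rewrite RintegralB//; [|exact: int|by apply: int => // z; exact: ltW].
rewrite /Rintegral !ge0_integral_empirical//=; last by move=> z; exact: ltW.
have -> : average (random_orbit f w x) phi n =
    average (random_orbit f w x) (fun z => (-1) * (fun=> M) z + (phi z + M)) n.
  by congr average; apply/funext => z; rewrite mulN1r addrC addrK.
by rewrite average_linear mulN1r addrC.
Qed.

End empirical.

Section convergence_of_averages.
Context (R : realType) (mu : probability (circle R) R).

Lemma average_cvg_of_partition (x : nat -> circle R) :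
  (forall n i, average x (partition_unity n i) k @[k --> \oo] -->
     \int[mu]_z partition_unity n i z) ->
  forall phi : circle R -> R, continuous phi ->
  average x phi k @[k --> \oo] --> \int[mu]_z phi z.
Proof.
move=> H phi phic; apply/cvgrPdist_le => e e0.
have [M M0 phiM] := circle_continuous_bounded phic.
have mphi := circle_continuous_measurable phic.
have e30 : 0 < e / 3 by rewrite divr_gt0.
have [n Hn] := partition_unity_approx phic e30.
pose c i := phi (nth point (net R n) i).
pose phi' z := \sum_(i < size (net R n)) c i * partition_unity n i z.
have mpu i : measurable_fun setT (@partition_unity R n i).
  by apply: circle_continuous_measurable; exact: partition_unity_continuous.
have mphi' : measurable_fun setT phi'.
  by apply: measurable_sum => i; exact: measurable_funM.
have phi'M z : `|phi' z| <= M + e / 3.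
  rewrite -[phi' z](subrK (phi z)) addrC (le_trans (ler_normD _ _))// lerD//.
  by rewrite distrC; exact: Hn.
have avgE k : average x phi' k =
    \sum_(i < size (net R n)) c i * average x (partition_unity n i) k.
  rewrite /average /phi' exchange_big/= mulr_sumr; apply: eq_bigr => i _.
  by rewrite mulrCA -mulr_sumr.
have avg' : average x phi' k @[k --> \oo] --> \int[mu]_z phi' z.
  rewrite (@Rintegral_sum _ _ _ _ _ _ 1)//; last exact: partition_unity_norm_le1.
  under eq_cvg do rewrite avgE.
  apply: cvg_big => [|i _]; first exact: add_continuous.
  by apply: cvgM; [exact: cvg_cst|exact: H].
have int' : `|\int[mu]_z phi z - \int[mu]_z phi' z| <= e / 3.
  rewrite -RintegralB//.
  - by apply: Rintegral_bounded => //; exact: measurable_funB.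
  - exact: (bounded_integrable mu mphi phiM).
  - exact: (bounded_integrable mu mphi' phi'M).
have avgd k : `|average x phi' k - average x phi k| <= e / 3.
  have -> : average x phi' k - average x phi k =
    average x (fun z => (-1) * phi z + phi' z) k.
    by rewrite average_linear mulN1r addrC.
  apply: average_le => z; rewrite mulN1r addrC distrC; exact: Hn.
move/cvgrPdist_le : avg' => /(_ _ e30); apply: filterS => k Hk.
have -> : \int[mu]_z phi z - average x phi k =
  (\int[mu]_z phi z - \int[mu]_z phi' z) +
  ((\int[mu]_z phi' z - average x phi' k) + (average x phi' k - average x phi k)).
  by ring.
have -> : e = e / 3 + (e / 3 + e / 3) by field.
rewrite (le_trans (ler_normD _ _))// lerD//.
by rewrite (le_trans (ler_normD _ _))// lerD.
Qed.

End convergence_of_averages.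

Lemma measurable_cvg_set d (Z : measurableType d) (R : realType)
    (u : nat -> Z -> R) (l : R) : (forall k, measurable_fun setT (u k)) ->
  measurable [set z | u k z @[k --> \oo] --> l].
Proof.
move=> mu.
have -> : [set z | u k z @[k --> \oo] --> l] =
    \bigcap_n \bigcup_N \bigcap_(k in [set k | (N <= k)%N])
      (setT `&` (fun z => `|l - u k z|) @^-1` `]-oo, n.+1%:R^-1]).
  apply/seteqP; split => z /=.
    move=> /cvgrPdist_le H n _.
    have /H[N _ HN] : 0 < n.+1%:R^-1 :> R by rewrite invr_gt0.
    by exists N => // k /= Nk; split => //; rewrite /= in_itv/=; exact: HN.
  move=> H; apply/cvgrPdist_le => e e0.
  have [N _ HN] := H (Num.truncn e^-1) I.
  exists N => // k /= Nk; have [_] := HN k Nk.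
  rewrite /= in_itv/= => /le_trans; apply.
  by rewrite -[leRHS]invrK lef_pV2 ?posrE ?invr_gt0// ltW// truncnS_gt.
apply: bigcapT_measurable => n; apply: bigcup_measurable => N _.
apply: bigcap_measurableType => k _.
suff : measurable_fun setT (fun z => `|l - u k z|) by apply => //; exact: measurable_itv.
apply: measurableT_comp => //; exact: measurable_funB.
Qed.

Lemma product_measure_ysection d d' (X : measurableType d)
    (Y : measurableType d') (R : realType) (m1 : probability X R)
    (m2 : probability Y R) B : measurable B ->
  (m1 \x m2)%E B = (\int[m2]_y m1 (ysection B y))%E.
Proof.
move=> mB; rewrite (product_measure_unique (m1 := m1) (m2 := m2)
  (m' := (m1 \x^ m2)%E))// => A1 A2 mA1 mA2.
exact: product_measure2E.
Qed.

Lemma ae_ysection_null d d' (X : measurableType d) (Y : measurableType d')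
    (R : realType) (m1 : probability X R) (m2 : probability Y R) Z :
  measurable Z -> (m1 \x m2)%E Z = 0%E ->
  {ae m2, forall y, m1 (ysection Z y) = 0%E}.
Proof.
move=> mZ Z0; have my : measurable_fun setT (fun y => m1 (ysection Z y)).
  exact: measurable_fun_ysection.
have : ae_eq m2 setT (fun y => m1 (ysection Z y)) (cst 0%E).
  apply/ae_eq_integral_abs => //; rewrite -Z0 product_measure_ysection//.
  by apply: eq_integral => y _; rewrite gee0_abs.
by apply: filterS => y /(_ Logic.I).
Qed.

(** Fubini for properties that hold almost everywhere on each horizontal
   section. *)
Lemma ae_xsection_full d d' (X : measurableType d) (Y : measurableType d')
    (R : realType) (m1 : probability X R) (m2 : probability Y R) B :
  measurable B -> (forall y, {ae m1, forall x, B (x, y)}) ->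
  {ae m1, forall x, m2 (xsection B x) = 1%E}.
Proof.
move=> mB aeB.
have nullB : (\int[m1]_x m2 (xsection (~` B) x) = 0)%E.
  transitivity ((m1 \x m2)%E (~` B)) => //.
  rewrite product_measure_ysection; last exact: measurableC.
  apply: integral0_eq => y _.
  have /negligibleP -> // : m1.-negligible (ysection (~` B) y).
    by apply: negligibleS (aeB y) => x; rewrite ysectionE.
  by apply: measurable_ysection; exact: measurableC.
have mx : measurable_fun setT (fun x => m2 (xsection (~` B) x)).
  by apply: measurable_fun_xsection; exact: measurableC.
have : ae_eq m1 setT (fun x => m2 (xsection (~` B) x)) (cst 0%E).
  apply/ae_eq_integral_abs => //; rewrite -[RHS]nullB.
  by apply: eq_integral => x _; rewrite gee0_abs.
apply: filterS => x /(_ Logic.I)/= m20.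
have mBx : measurable (xsection B x) by exact: measurable_xsection.
rewrite -[xsection B x]setCK probability_setC; last exact: measurableC.
rewrite (_ : ~` xsection B x = xsection (~` B) x) ?m20 ?sube0//.
by apply/seteqP; split => y; rewrite !xsectionE.
Qed.

Lemma ae_exists d (X : measurableType d) (R : realType)
    (m : probability X R) (Q : X -> Prop) :
  {ae m, forall x, Q x} -> exists x, Q x.
Proof.
move=> [N [mN N0 NN]]; apply: contrapT => nQ.
have : m setT = 0%E.
  apply/eqP; rewrite eq_le measure_ge0 andbT -N0 le_measure ?inE// => x _.
  by apply: NN => /= Qx; apply: nQ; exists x.
by move/eqP; rewrite measure_probT onee_eq0.
Qed.

Section almost_every_basin.
Context d (T : measurableType d) (R : realType).
Variables (f : T -> circle R -> circle R) (p : probability T R).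
Variable P : probability (Omega T) R.
Hypothesis Pprod : product_law p P.
Hypotheses (Tfin : finite_set [set: T]) (fc : forall t, continuous (f t)).
Hypothesis mf : measurable_fun setT (fun z : T * circle R => f z.1 z.2).
Variable mu : probability (circle R) R.

(** Testing on the countable family is what makes basins measurable, jointly
   in the word and the point. *)
Lemma basinP w x : basin f w mu x <->
  forall n i, average (random_orbit f w x) (partition_unity n i) k @[k --> \oo]
    --> \int[mu]_z partition_unity n i z.
Proof.
split => [bx n i|H phi phic].
  have puc := @partition_unity_continuous R n i.
  have e : (fun k => \int[empirical_measure f w x k]_z partition_unity n i z) =
           average (random_orbit f w x) (partition_unity n i).
    by apply/funext => k; rewrite Rintegral_empirical.
  by rewrite -e; exact: bx.
under eq_cvg do rewrite Rintegral_empirical//.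
exact: average_cvg_of_partition.
Qed.

Lemma measurable_basin :
  measurable [set z : Omega T * circle R | basin f z.1 mu z.2].
Proof.
have -> : [set z : Omega T * circle R | basin f z.1 mu z.2] =
  \bigcap_n \bigcap_i [set z : Omega T * circle R |
    average (random_orbit f z.1 z.2) (partition_unity n i) k @[k --> \oo]
    --> \int[mu]_z partition_unity n i z].
  apply/seteqP; split => z /=.
    by move=> /basinP H n _ i _; exact: H.
  by move=> H; apply/basinP => n i; exact: (H n Logic.I i Logic.I).
apply: bigcapT_measurable => n; apply: bigcapT_measurable => i.
apply: measurable_cvg_set => k; apply: measurable_funM => //.
apply: measurable_sum => j.
have h := circle_continuous_measurable (@partition_unity_continuous R n i).
exact: (measurableT_comp h (measurable_random_orbit mf j)).
Qed.

Hypothesis mu_stat : unique_stationary f p mu.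

Theorem ae_basin_of_point x : {ae P, forall w, basin f w mu x}.
Proof.
have H : {ae P, forall w, forall n i, average (random_orbit f w x)
    (fun z => partition_unity n i z - transition f p (partition_unity n i) z) k
    @[k --> \oo] --> (0 : R)}.
  apply/ae_foralln => n; apply/ae_foralln => i.
  have puc := @partition_unity_continuous R n i.
  apply: (orbit_average_defect mf Pprod _ _ ltr01) => //.
  - exact: circle_continuous_measurable.
  - by apply: circle_continuous_measurable; exact: transition_continuous.
  - exact: partition_unity_norm_le1.
apply: filterS H => w H; apply/basinP => n i.
exact: (average_cvg_of_defect Tfin fc mf mu_stat H
  (@partition_unity_continuous R n i)).
Qed.

Theorem ae_basin_full (m : probability (circle R) R) :
  {ae P, forall w, m (basin f w mu) = 1%E}.
Proof.
have := ae_xsection_full m measurable_basin ae_basin_of_point.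
apply: filterS => w <-; congr (m _).
by apply/seteqP; split => x; rewrite xsectionE.
Qed.

(** The orbit of a point of K never leaves K, so along a typical word its
   averages of the inner approximations of the complement of K are 0; their
   limits are the mu-integrals, which increase to the measure of this
   complement. *)
Lemma stationary_invariant_closed (K : set (circle R)) :
  K !=set0 -> closed K -> (forall t x, K x -> K (f t x)) -> mu K = 1%E.
Proof.
move=> [x Kx] Kc Kinv.
have Ko : open (~` K) by exact: closed_openC.
have mK := circle_closed_measurable Kc.
have [w bw] := ae_exists (ae_basin_of_point x).
have orbK j : K (random_orbit f w x j) by elim: j => //= j; exact: Kinv.
have int0 n : (\int[mu]_z (inner n (~` K) z)%:E = 0)%E.
  have ic : continuous (@inner R n (~` K)) by exact: inner_continuous.
  rewrite EFin_Rintegral; last first.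
    apply: (@bounded_integrable _ _ _ _ _ 1); last exact: inner_norm_le1.
    exact: circle_continuous_measurable.
  congr EFin; apply/esym; have := bw _ ic.
  under eq_cvg do rewrite Rintegral_empirical//.
  apply: cvg_unique => //.
  rewrite (_ : average _ _ = cst 0); first exact: cvg_cst.
  apply/funext => k; rewrite /average big1 ?mulr0// => j _.
  by rewrite inner_out// => /(_ (orbK j)).
have := @integral_inner_cvg R mu (~` K) Ko.
under eq_cvg do rewrite int0.
move=> /(cvg_unique (@ereal_hausdorff _) (cvg_cst _)) muK0.
by rewrite -[K]setCK probability_setC ?sube0; [rewrite -muK0 sube0|exact: measurableC].
Qed.

End almost_every_basin.

(** * Uniqueness of the stationary measure implies ergodicity *)

Section ergodicity.
Context d d' (T : measurableType d) (X : measurableType d') (R : realType).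
Variables (f : T -> X -> X) (p : probability T R) (P : probability (Omega T) R).
Hypothesis mf : measurable_fun setT (fun z : T * X => f z.1 z.2).
Hypothesis Pprod : product_law p P.

Lemma measurable_skew_product : measurable_fun setT (@skew_product _ _ T X f).
Proof.
apply/measurable_fun_pair.
  exact: (measurableT_comp (@measurable_shift _ T) measurable_fst).
exact: (measurable_random_orbit mf 1).
Qed.

Let measurable_preim (A : set X) : measurable A ->
  measurable ((fun z : T * X => f z.1 z.2) @^-1` A).
Proof. by move=> mA; rewrite -[X in measurable X]setTI; exact: mf. Qed.

Section stationary_measure.
Variable mu : probability X R.
Hypothesis statmu : stationary f p mu.

Lemma stationary_product A : measurable A ->
  (p \x mu)%E ((fun z : T * X => f z.1 z.2) @^-1` A) = mu A.
Proof.
move=> mA; rewrite statmu//; apply: eq_integral => t _ /=.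
by rewrite xsectionE.
Qed.

Lemma Rintegral_stationary (g : X -> R) (M : R) : measurable_fun setT g ->
  (forall x, `|g x| <= M) ->
  \int[mu]_x g x = \int[(p \x mu)%E]_z g (f z.1 z.2).
Proof.
move=> mg gM; rewrite /Rintegral; congr fine.
have mgf : measurable_fun setT (g \o (fun z : T * X => f z.1 z.2)).
  exact: measurableT_comp.
rewrite (eq_measure_integral (image_probability mf (p \x mu)%E)); last first.
  by move=> A mA _; exact/esym/stationary_product.
rewrite /image_probability integral_distribution//; first exact/measurable_EFinP.
exact: (bounded_integrable _ mgf (fun z => gM _)).
Qed.

Lemma Rintegral_product (g : T * X -> R) (M : R) : measurable_fun setT g ->
  (forall z, `|g z| <= M) ->
  \int[(p \x mu)%E]_z g z = \int[mu]_x \int[p]_t g (t, x).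
Proof.
move=> mg gM; rewrite /Rintegral.
rewrite -(integral21_prod_meas1 (bounded_integrable _ mg gM)); congr fine.
apply: eq_integral => x _; rewrite /fubini_G/= EFin_Rintegral//.
by apply: (@bounded_integrable _ _ _ _ _ M) => //; exact: measurable_fun_pair1 mg.
Qed.

(** In L^2(p x mu), the square of the distance between h (f t x) and h x is
   int h^2 - 2 int h (Q h) + int h^2 by stationarity, and Q h = h makes it
   vanish. *)
Lemma harmonic_ae_invariant (h : X -> R) : measurable_fun setT h ->
  (forall x, `|h x| <= 1) -> (forall x, \int[p]_t h (f t x) = h x) ->
  {ae (p \x mu)%E, forall z, h (f z.1 z.2) = h z.2}.
Proof.
move=> mh h1 hh.
pose ht (z : T * X) := h (f z.1 z.2).
pose hx (z : T * X) := h z.2.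
have mht : measurable_fun setT ht by exact: measurableT_comp mh mf.
have mhx : measurable_fun setT hx by exact: measurableT_comp mh measurable_snd.
have prod1 (a b : R) : `|a| <= 1 -> `|b| <= 1 -> `|a * b| <= 1.
  by move=> a1 b1; rewrite normrM -[leRHS]mul1r ler_pM.
have itt : \int[(p \x mu)%E]_z (ht z * ht z) = \int[mu]_x (h x * h x).
  rewrite (@Rintegral_stationary (fun x => h x * h x) 1)// => [|x].
    exact: measurable_funM.
  exact: prod1.
have itx : \int[(p \x mu)%E]_z (ht z * hx z) = \int[mu]_x (h x * h x).
  rewrite (@Rintegral_product _ 1)//.
  - apply: eq_Rintegral => x _; rewrite /ht /hx/= RintegralZr ?hh//.
    apply: (@bounded_integrable _ _ _ _ _ 1) => //.
    by apply: measurableT_comp mh _; exact: measurable_fun_pair1 mf.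
  - exact: measurable_funM.
  - by move=> z; apply: prod1; exact: h1.
have ixx : \int[(p \x mu)%E]_z (hx z * hx z) = \int[mu]_x (h x * h x).
  rewrite (@Rintegral_product _ 1)//.
  - by apply: eq_Rintegral => x _; rewrite /hx/= Rintegral_prob_cst.
  - exact: measurable_funM.
  - by move=> z; apply: prod1; exact: h1.
have msq : measurable_fun setT (fun z => (ht z - hx z) ^+ 2).
  by apply: measurable_funX; exact: measurable_funB.
have ib (u v : T * X -> R) : measurable_fun setT u -> measurable_fun setT v ->
    (forall z, `|u z| <= 1) -> (forall z, `|v z| <= 1) ->
    (p \x mu)%E.-integrable setT (EFin \o (fun z => u z * v z)).
  move=> mu' mv u1 v1; apply: (@bounded_integrable _ _ _ _ _ 1).
    exact: measurable_funM.
  by move=> z; apply: prod1.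
have htt := ib _ _ mht mht (fun z => h1 _) (fun z => h1 _).
have htx := ib _ _ mht mhx (fun z => h1 _) (fun z => h1 _).
have hxx := ib _ _ mhx mhx (fun z => h1 _) (fun z => h1 _).
have sq0 : \int[(p \x mu)%E]_z ((ht z - hx z) ^+ 2) = 0.
  transitivity (\int[(p \x mu)%E]_z
    ((ht z * ht z - ht z * hx z) - (ht z * hx z - hx z * hx z))).
    by apply: eq_Rintegral => z _; rewrite expr2; ring.
  rewrite RintegralB//; last 2 first.
  - by have := integrableB measurableT htt htx.
  - by have := integrableB measurableT htx hxx.
  by rewrite !RintegralB// itt itx ixx; ring.
have : ae_eq (p \x mu)%E setT (fun z => ((ht z - hx z) ^+ 2)%:E) (cst 0%E).
  apply/ae_eq_integral_abs => //; first exact/measurable_EFinP.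
  under eq_integral => z _ do rewrite /= ger0_norm ?sqr_ge0//.
  rewrite EFin_Rintegral ?sq0//.
  apply: (@bounded_integrable _ _ _ _ _ ((1 + 1) ^+ 2)) => // z.
  rewrite normrX lerXn2r ?nnegrE//.
  by apply: (le_trans (ler_normB _ _)); exact: (lerD (h1 _) (h1 _)).
apply: filterS => z /(_ Logic.I) [] /eqP.
by rewrite sqrf_eq0 subr_eq0 => /eqP.
Qed.

End stationary_measure.


Section invariant_set.
Variable mu : probability X R.
Hypothesis mu_stat : unique_stationary f p mu.
Variable A : set (Omega T * X).
Hypotheses (mA : measurable A) (Ainv : @skew_product _ _ T X f @^-1` A = A).

Let statmu : stationary f p mu := mu_stat.1.

(** Invariance of A, read on sections: the word t w belongs to A_x exactly
   when w belongs to the section at f t x. *)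
Lemma ysection_invariant t w x :
  ysection A x (prepend (t, w)) <-> ysection A (f t x) w.
Proof.
rewrite !ysectionE /=; split => [|H]; first by rewrite -{1}Ainv.
by rewrite -Ainv.
Qed.

Let mAx x : measurable (ysection A x).
Proof. exact: measurable_ysection. Qed.

Let h x : R := fine (P (ysection A x)).

Let hE x : P (ysection A x) = (h x)%:E.
Proof. by rewrite /h fineK// fin_num_measure. Qed.

Let h01 x : 0 <= h x <= 1.
Proof. by rewrite -!lee_fin -hE measure_ge0 probability_le1. Qed.

Let h_norm x : `|h x| <= 1.
Proof. by have /andP[h0 h1] := h01 x; rewrite ger0_norm. Qed.

Let mh : measurable_fun setT h.
Proof.
apply: measurableT_comp => //.
exact: measurable_fun_ysection.
Qed.

Let harmonic x : \int[p]_t h (f t x) = h x.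
Proof.
rewrite /Rintegral {2}/h; congr fine.
rewrite (prepend_law Pprod (mAx x)); apply: eq_integral => t _ /=.
rewrite -hE; congr (P _); apply/seteqP; split => w; rewrite xsectionE /=.
  by move=> /ysection_invariant.
by move=> H; apply/ysection_invariant.
Qed.

Let Pm : probability (Omega T * X)%type R := (P \x mu)%E.

Lemma measure_rectangle E B : measurable E -> measurable B ->
  Pm (A `&` (E `*` B)) = (\int[mu]_(x in B) P (ysection A x `&` E))%E.
Proof.
move=> mE mB; have mS : measurable (A `&` (E `*` B)).
  by apply: measurableI => //; exact: measurableX.
rewrite [LHS]product_measure_ysection// [RHS]integral_mkcond.
apply: eq_integral => x _; rewrite /patch; case: ifPn => [/set_mem|/negP] Bx.
  congr (P _); apply/seteqP; split => w; rewrite !ysectionE /=.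
    by move=> [? []].
  by move=> [].
rewrite (_ : ysection _ _ = set0) ?measure0//.
apply/seteqP; split => // w; rewrite ysectionE /= => -[_ [_ /=]] xB.
by apply: Bx; exact: mem_set.
Qed.

Lemma measure_strip B : measurable B ->
  Pm (A `&` (setT `*` B)) = (\int[mu]_(x in B) (h x)%:E)%E.
Proof.
move=> mB; rewrite measure_rectangle//.
by apply: eq_integral => x _; rewrite setIT hE.
Qed.

Hypothesis A0 : Pm A != 0%E.

Let c := fine (Pm A).

Let cE : Pm A = c%:E.
Proof. by rewrite /c fineK// fin_num_measure. Qed.

Let c0 : c != 0.
Proof. by apply: contra A0; rewrite cE => /eqP ->. Qed.

Let m_A : probability (Omega T * X)%type R := mnormalize (mrestr Pm mA) Pm.

Let m_AE Z : m_A Z = (Pm (Z `&` A) * c^-1%:E)%E.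
Proof.
have -> : m_A Z = mnormalize (mrestr Pm mA) Pm Z by [].
rewrite /mnormalize/=; set s := mrestr Pm mA _.
have -> : s = c%:E by rewrite /s /mrestr -cE; congr (Pm _); exact: setTI.
by rewrite eqe (negbTE c0).
Qed.

Let nu : probability X R :=
  image_probability (@measurable_snd _ _ (Omega T) X) m_A.

Let nuE B : measurable B ->
  nu B = ((\int[mu]_(x in B) (h x)%:E) * c^-1%:E)%E.
Proof.
move=> mB; rewrite -measure_strip//.
have -> : nu B = m_A (snd @^-1` B) by [].
rewrite m_AE setIC; congr (Pm _ * _)%E; congr (_ `&` _).
by apply/seteqP; split => z //= [].
Qed.

(** The second marginal of P x mu conditioned on A has density h / c with
   respect to mu. Since h (f t x) = h x almost everywhere, the density can be
   moved from x to f t x, where stationarity of mu applies. *)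
Lemma invariant_marginal_stationary : stationary f p nu.
Proof.
move=> B mB.
have mfB := measurable_preim mB.
have mft t : measurable_fun setT (f t) by exact: measurable_fun_pair2 t mf.
have mfBt t : measurable (f t @^-1` B).
  by rewrite -[X in measurable X]setTI; exact: mft.
have inv := harmonic_ae_invariant statmu mh h_norm harmonic.
pose g x : R := \1_B x * h x.
have mg : measurable_fun setT g by apply: measurable_funM => //; exact: measurable_indic.
have g1 x : `|g x| <= 1.
  rewrite normrM -[leRHS]mul1r ler_pM// indicE.
  by case: (x \in B); rewrite ?normr1 ?normr0.
have intB (E : set X) : measurable E ->
    (\int[mu]_(x in E) (h x)%:E = \int[mu]_x (\1_E x * h x)%:E)%E.
  move=> mE; rewrite [LHS]integral_mkcond; apply: eq_integral => x _.
  rewrite /patch indicE; case: (x \in E); first by rewrite mul1r.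
  by rewrite mul0r.
have mB1 : measurable_fun setT (fun z : T * X => \1_B (f z.1 z.2) : R).
  by apply: measurableT_comp mf; exact: measurable_indic.
have mh2 : measurable_fun setT (fun z : T * X => h z.2).
  exact: measurableT_comp mh measurable_snd.
pose k (z : T * X) : R := \1_B (f z.1 z.2) * h z.2.
have mk : measurable_fun setT k by exact: measurable_funM.
have k0 z : (0 <= (k z)%:E)%E.
  by rewrite lee_fin mulr_ge0//; have /andP[] := h01 z.2.
transitivity ((\int[(p \x mu)%E]_z (k z)%:E) * c^-1%:E)%E.
  rewrite nuE// intB//; congr (_ * _)%E.
  rewrite EFin_Rintegral; last exact: bounded_integrable mg g1.
  rewrite (Rintegral_stationary statmu mg g1).
  rewrite -EFin_Rintegral; last first.
    apply: (@bounded_integrable _ _ _ _ (fun z : T * X => g (f z.1 z.2)) 1) => //.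
    exact: measurableT_comp mg mf.
  apply: ae_eq_integral => //.
  - by apply/measurable_EFinP; exact: measurableT_comp mg mf.
  - exact/measurable_EFinP.
  - by apply: filterS inv => z /= e _; rewrite /g /k e.
rewrite (fubini_tonelli1 (m1 := p) (m2 := mu) (fun z => (k z)%:E))//; last first.
  exact/measurable_EFinP.
rewrite -ge0_integralZr//.
- by apply: eq_integral => t _; rewrite nuE// intB.
- apply: measurable_fun_fubini_tonelli_F => //; exact/measurable_EFinP.
- by move=> t _; apply: integral_ge0.
- by rewrite lee_fin invr_ge0 fine_ge0.
Qed.

(** The marginal equals mu by uniqueness, so its density h / c is 1. *)
Lemma ae_ysection_constant : {ae mu, forall x, P (ysection A x) = c%:E}.
Proof.
have numu := mu_stat.2 _ invariant_marginal_stationary.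
have : ae_eq mu setT (fun x => (h x)%:E) (cst c%:E).
  apply: integral_ae_eq => //.
  - exact: (bounded_integrable mu mh h_norm).
  - move=> B _ mB; rewrite integral_cst//.
    have <- : ((\int[mu]_(x in B) (h x)%:E) * c^-1%:E)%E =
              (mu : {measure set X -> \bar R}) B.
      by rewrite -nuE//; exact: numu.
    by rewrite muleC -muleA -EFinM mulVf// mule1.
by apply: filterS => x /(_ Logic.I); rewrite hE.
Qed.

(** Splitting off the first letter t, the section of A at x intersected with a
   box becomes the section at f t x intersected with a shorter box; the
   exceptional set of the induction hypothesis pulls back to a null set by
   stationarity. *)
Lemma ae_ysection_box n C : (forall i, measurable (C i)) ->
  {ae mu, forall x, P (ysection A x `&` box n C) = (c%:E * P (box n C))%E}.
Proof.
elim: n C => [|n ih] C mC.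
  have box0 : box 0 C = setT by apply/seteqP.
  apply: filterS ae_ysection_constant => x; rewrite box0 setIT => ->.
  by rewrite measure_probT mule1.
pose C' i := C i.+1.
have boxS : P (box n.+1 C) = (p (C 0%N) * P (box n C'))%E.
  rewrite [LHS]Pprod// big_ord_recl; congr (_ * _)%E.
  by apply/esym/Pprod => i; exact: mC.
have [N [mN N0 subN]] := ih C' (fun i => mC i.+1).
have NZ : (p \x mu)%E ((fun z : T * X => f z.1 z.2) @^-1` N) = 0%E.
  by rewrite (stationary_product statmu)//; exact: N0.
apply: filterS (ae_ysection_null (measurable_preim mN) NZ) => x px0.
have mAC : measurable (ysection A x `&` box n.+1 C).
  by apply: measurableI => //; exact: measurable_box.
rewrite (prepend_law Pprod mAC).
transitivity (\int[p]_t ((\1_(C 0%N) t)%:E * (c%:E * P (box n C'))))%E.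
  have mpre : measurable (@prepend _ T @^-1` (ysection A x `&` box n.+1 C)).
    by rewrite -[X in measurable X]setTI; exact: measurable_prepend.
  apply: ae_eq_integral => //.
  - exact: measurable_fun_xsection.
  - apply: emeasurable_funM => //; apply/measurable_EFinP.
    exact: measurable_indic.
  - exists (ysection ((fun z : T * X => f z.1 z.2) @^-1` N) x); split => //.
      by apply: measurable_ysection; exact: measurable_preim.
    move=> t /= nt; rewrite ysectionE /=; apply: subN => /= e; apply: nt => _.
    rewrite indicE; case: (boolP (t \in C 0%N)) => [/set_mem Ct|/negP Ct].
      rewrite mul1e -e; congr (P _); apply/seteqP; split => w; rewrite xsectionE /=.
        move=> [/ysection_invariant Aw bw]; split => // i il.
        exact: (bw i.+1).
      move=> [Aw bw]; split; first exact/ysection_invariant.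
      by move=> [|i] // il; exact: bw.
    rewrite mul0e (_ : xsection _ _ = set0) ?measure0//.
    apply/seteqP; split => // w; rewrite xsectionE /= => -[_ /(_ 0%N isT)] Ct'.
    by apply: Ct; exact: mem_set.
have m1 : measurable_fun setT (fun t : T => (\1_(C 0%N) t : R)%:E).
  by apply/measurable_EFinP; exact: measurable_indic.
rewrite ge0_integralZr//; last by rewrite mule_ge0// lee_fin fine_ge0.
have -> : (\int[p]_t (\1_(C 0%N) t)%:E = p (C 0%N))%E.
  by rewrite integral_indic// setIT.
by rewrite boxS muleCA.
Qed.

(** P x mu conditioned on A agrees with P x mu on rectangles, hence
   everywhere, in particular on the complement of A, where it vanishes. *)
Lemma invariant_set_full : Pm A = 1%E.
Proof.
have c_ge0 : 0 <= c by rewrite fine_ge0.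
have cond_rect C B : measurable C -> measurable B -> m_A (C `*` B) = (P C * mu B)%E.
  move=> mC mB; have mS : measurable ([set: Omega T] `*` B) by exact: measurableX.
  have kB : 0 <= fine (mu B) by rewrite fine_ge0.
  (* For fixed B, both sides are finite measures in C, so it suffices to
     compare them on boxes. *)
  pose q1 := image_measure (@measurable_fst _ _ (Omega T) X) (mrestr m_A mS).
  pose q2 : {measure set (Omega T) -> \bar R} := mscale (NngNum kB) P.
  have q1E E : q1 E = m_A (E `*` B).
    rewrite -[LHS]/(m_A (fst @^-1` E `&` ([set: Omega T] `*` B))).
    by congr (m_A _); apply/seteqP; split => z /= [] //; tauto.
  have q2E E : q2 E = (P E * mu B)%E.
    by rewrite muleC -[mu B]fineK ?fin_num_measure.
  rewrite -q1E -q2E; move: C mC; apply: Omega_measure_unique.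
    rewrite q1E; apply: (le_lt_trans (probability_le1 m_A _) (ltry 1)).
    exact: measurableX.
  move=> n C mC; have mbox := measurable_box n mC.
  rewrite q1E q2E m_AE setIC measure_rectangle//.
  have -> : (\int[mu]_(x in B) P (ysection A x `&` box n C) =
             \int[mu]_(x in B) cst (c%:E * P (box n C)) x)%E.
    apply: ae_eq_integral => //.
    - apply: measurable_funTS.
      rewrite (_ : (fun x => _) =
        fun x => P (ysection (A `&` (box n C `*` setT)) x)).
        apply: measurable_fun_ysection.
        by apply: measurableI => //; exact: measurableX.
      apply/funext => x; congr (P _); apply/seteqP; split => w; rewrite !ysectionE /=.
        by move=> [].
      by move=> [? []].
    - by apply: filterS (ae_ysection_box n mC) => x e _.
  by rewrite integral_cst// muleC !muleA -EFinM mulVf// mul1e.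
have PmE Z : measurable Z -> Pm Z = m_A Z.
  by move=> mZ; apply: product_measure_unique.
have mCA : measurable (~` A) by exact: measurableC.
have : Pm (~` A) = 0%E.
  by rewrite PmE// m_AE setICl measure0 mul0e.
rewrite probability_setC// cE -EFinB => -[] /eqP; rewrite subr_eq0 => /eqP <-.
by [].
Qed.

End invariant_set.

(** Invariance of P x mu under the skew product is tested on rectangles, by
   splitting off the first letter. *)
Theorem ergodic_of_unique (mu : probability X R) :
  unique_stationary f p mu -> ergodic_stationary f p P mu.
Proof.
move=> mu_stat; have statmu := mu_stat.1.
have mF := measurable_skew_product.
split => //; split => //.
  move=> A mA; apply/esym.
  pose m' := image_measure mF (P \x mu)%E.
  rewrite -[RHS]/(m' A); apply: product_measure_unique => // C B mC mB.
  rewrite -[LHS]/((P \x mu)%E (@skew_product _ _ T X f @^-1` (C `*` B))).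
  have mpre : measurable (@skew_product _ _ T X f @^-1` (C `*` B)).
    by have := mF measurableT _ (measurableX mC mB); rewrite setTI.
  rewrite product_measure_ysection//.
  have mfB := measurable_preim mB.
  transitivity (\int[mu]_x (p (ysection ((fun z : T * X => f z.1 z.2) @^-1` B) x) *
      P C))%E.
    apply: eq_integral => x _.
    rewrite (prepend_law Pprod); last exact: measurable_ysection.
    rewrite -product_measure1E//; last exact: measurable_ysection.
    congr ((p \x P)%E _); apply/seteqP; split => -[t w] /=; rewrite !ysectionE /=.
      by move=> [].
    by move=> [].
  rewrite ge0_integralZr//; last exact: measurable_fun_ysection.
  by rewrite -product_measure_ysection// stationary_product// muleC.
move=> A mA Ainv; have [A0|A0] := eqVneq ((P \x mu)%E A) 0%E; first by left.
by right; exact: invariant_set_full A0.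
Qed.

End ergodicity.

(** * The exceptional minimal set *)

(** The indicator function of K violates condition 3): orbits started outside
   K have averages 0, so all its basins are contained in K. *)
Lemma not_FPM3_of_escape d (T : measurableType d) d' (X : measurableType d')
    (R : realType) (f : T -> X -> X) (P : probability (Omega T) R)
    (m : probability X R) (K : set X) (r : nat) (mus : 'I_r -> probability X R) :
  measurable_fun setT (fun z : T * X => f z.1 z.2) ->
  measurable K -> (forall t x, ~ K x -> ~ K (f t x)) ->
  (m K < 1)%E -> (forall i, mus i K = 1%E) -> ~ FPM3 f P m mus.
Proof.
move=> mf mK escape mK1 musK fpm.
have mI : measurable_fun setT (\1_K : X -> R) by exact: measurable_indic.
have bI : bounded_fun (\1_K : X -> R).
  exists 1; split; first exact: num_real.
  move=> y y1 x _ /=; rewrite indicE (le_trans _ (ltW y1))//.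
  by case: (x \in K); rewrite ?normr1 ?normr0.
have [w mw] := ae_exists (fpm _ mI bI).
have sub : \bigcup_i basin_fun f w (mus i) (\1_K) `<=` K.
  move=> x [i _ bx]; apply: contrapT => Kx.
  have orb j : ~ K (random_orbit f w x j) by elim: j => //= j; exact: escape.
  have int1 : \int[mus i]_y (\1_K y : R) = 1.
    by rewrite /Rintegral integral_indic// setIT; exact: (congr1 fine (musK i)).
  move: bx; rewrite /basin_fun /= int1.
  rewrite (_ : (fun n => _) = cst 0); last first.
    apply/funext => n; rewrite big1 ?mulr0// => j _.
    by rewrite indicE memNset.
  by move=> /(cvg_unique _ (cvg_cst _))-/(_ (@Rhausdorff R)) /eqP; rewrite eq_sym oner_eq0.
have mU : measurable (\bigcup_i basin_fun f w (mus i) (\1_K)).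
  apply: fin_bigcup_measurable => [|i _]; first exact: finite_finset.
  apply: measurable_cvg_set => k; apply: measurable_funM => //.
  apply: measurable_sum => j.
  apply: (measurableT_comp mI).
  exact: measurable_fun_pair2 w (measurable_random_orbit mf j).
have : (m (\bigcup_i basin_fun f w (mus i) (\1_K)) <= m K)%E.
  by rewrite le_measure// ?inE.
by rewrite mw leNgt mK1.
Qed.

Section finite_alphabet.
Context (R : realType) (T : set (circle R -> circle R)) (T0 : T !=set0).
Hypothesis Tfin : finite_set T.
Hypothesis Thomeo : forall g, T g -> homeomorphism g.

Lemma finite_alphabet : finite_set [set: alphabet T0].
Proof. by rewrite /alphabet (eq_finite_set (card_setT T)). Qed.

Lemma alphabet_continuous (t : alphabet T0) : continuous (alphabet_map t).
Proof. by have [] := Thomeo (set_mem (valP t)). Qed.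

Lemma measurable_alphabet_map :
  measurable_fun setT (fun z : alphabet T0 * circle R => alphabet_map z.1 z.2).
Proof.
move=> _ B mB; rewrite setTI.
rewrite (_ : _ @^-1` _ = \bigcup_(t in [set: alphabet T0])
    ([set t] `*` (alphabet_map t @^-1` B))).
  apply: fin_bigcup_measurable => [|t _]; first exact: finite_alphabet.
  apply: measurableX => //.
  rewrite -[X in measurable X]setTI.
  exact: (circle_map_measurable (@alphabet_continuous t)).
apply/seteqP; split => [[t x] /= Bx|[t x] [s _ [/= -> Bx]]] //.
by exists t.
Qed.

End finite_alphabet.

Theorem proposition1p23 (R : realType)
    (T : set (circle R -> circle R)) (T0 : T !=set0)
    (Tfin : finite_set T)
    (Thomeo : forall g, T g -> homeomorphism g)
    (Tsym : symmetric_set T)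
    (p : probability (alphabet T0) R)
    (p_gt0 : forall g : alphabet T0, (0 < p [set g])%E)
    (P : probability (Omega (alphabet T0)) R)
    (Pprod : product_law p P)
    (K : set (circle R))
    (Kexc : exceptional_minimal_set (generated_group T) K)
    (mu : probability (circle R) R)
    (mu_stat : unique_stationary (@alphabet_map _ T T0) p mu)
    (I : set (circle R)) (Igap : gap K I)
    (eta : probability (circle R) R)
    (eta_leb : normalized_restriction (@circle_lebesgue R) I eta) :
  let f := @alphabet_map _ T T0 in
  let m : probability (circle R) R := half_sum mu eta in
  let mus : 'I_1 -> probability (circle R) R := fun=> mu in
  [/\ mu K = 1%E,
      ergodic_stationary f p P mu,
      FPM1 m mus /\ FPM2 m mus,
      {ae P, forall w, m (basin f w mu) = 1%E} &
      ~ FPM3 f P m mus /\ ~ FPM f p P m].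
Proof.
move=> f m mus.
have mf := measurable_alphabet_map (T0 := T0) Tfin Thomeo.
have fc := alphabet_continuous (T0 := T0) Thomeo.
have Afin := finite_alphabet T0 Tfin.
have [[K0 Kc Kinv _] _ _] := Kexc.
have mK := circle_closed_measurable Kc.
have fK (t : alphabet T0) : f t @` K = K.
  by apply: Kinv; apply: sub_gen_smallest; exact: set_mem (valP t).
have keep t x : K x -> K (f t x) by move=> Kx; rewrite -(fK t); exists x.
have escape t x : ~ K x -> ~ K (f t x).
  move=> Kx; rewrite -{1}(fK t) => -[y Ky fyx]; apply: Kx.
  have [_ [h [_ hK _]]] := Thomeo _ (set_mem (valP t)).
  by rewrite -(hK x) -[\val t x]fyx hK.
have muK : mu K = 1%E.
  exact: (stationary_invariant_closed Pprod Afin fc mf mu_stat K0 Kc keep).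
have etaK : eta K = 0%E.
  have [x _ IE] := Igap.
  rewrite eta_leb// (_ : K `&` I = set0).
    by rewrite /circle_lebesgue preimage_set0 setI0 measure0 mul0e.
  apply/seteqP; split => // y [Ky]; rewrite IE.
  by move=> /connected_component_sub.
have mE A : m A = (2^-1%:E * (mu A + eta A))%E.
  by rewrite -measure_addE.
have mK1 : (m K < 1)%E.
  by rewrite mE muK etaK adde0 mule1 lte_fin invf_lt1// ltr1n.
have noFPM3 r (nus : 'I_r -> probability (circle R) R) :
    (forall i, stationary f p (nus i)) -> ~ FPM3 f P m nus.
  move=> nus_stat; apply: (not_FPM3_of_escape mf mK escape mK1) => i.
  by rewrite -muK; exact: mu_stat.2.
split => //.
- exact: ergodic_of_unique.
- split; last by move=> i j; rewrite !ord1 eqxx.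
  move=> i; apply/null_content_dominatesP => A mA mA0.
  have : (mu A + eta A = 0)%E.
    move: mA0; rewrite [LHS]mE => /eqP; rewrite mule_eq0 eqe invr_eq0 pnatr_eq0/=.
    by move=> /eqP.
  by move=> s0; apply/eqP; rewrite eq_le measure_ge0 andbT -s0 leeDl.
- exact: (ae_basin_full Pprod Afin fc mf mu_stat).
- split; first by apply: noFPM3 => i; exact: mu_stat.1.
  move=> [r [nus [nus_erg _ _ fpm3]]].
  by apply: noFPM3 fpm3 => i; have [] := nus_erg i.
Qed.
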